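(* Let $\mathrm w=(w_k,k\ge0)$ be a sequence of non-negative real weights with $w_0>0$ and with $w_k>0$ for some $k\ge2$. For $n$ with $Z_n(\mathrm w)>0$ let $\mathcal T_n$ be a simply generated tree of size $n$ with weight sequence $\mathrm w$. If $\nu<1$, or if $\nu=1$ and $\sigma^2=\infty$, then, as $n\to\infty$ along integers $n$ with $Z_n(\mathrm w)>0$, $$\frac{\mathrm{ht}(\mathcal T_n)}{n^{1/2}\log^3 n}\to 0\quad\text{and}\quad \frac{\mathrm{wid}(\mathcal T_n)}{n^{1/2}}\to\infty\quad\text{in probability}.$$
   Context: A plane tree is a finite rooted tree in which the children of each node are ordered from left to right; the degree of a node is its number of children. For a plane tree $t$, $\mathrm w(t)=\prod_{v\in t}w_{d_t(v)}$, where $d_t(v)$ is the degree of $v$; $Z_n(\mathrm w)=\sum_{t}\mathrm w(t)$, the sum over plane trees with $n$ vertices. When $Z_n(\mathrm w)>0$, the simply generated tree $\mathcal T_n$ of size $n$ with weight sequence $\mathrm w$ is the random plane tree with $\mathbf P\{\mathcal T_n=t\}=\mathrm w(t)/Z_n(\mathrm w)$ for each plane tree $t$ with $n$ vertices. Let $\Phi(z)=\sum_{k\ge0}w_kz^k$, with radius of convergence $\rho\in[0,\infty]$. For $t\ge 0$ with $\Phi(t)<\infty$ let $\Psi(t)=t\Phi'(t)/\Phi(t)=\sum_k kw_kt^k/\sum_k w_kt^k\in[0,\infty]$; if $\Phi(\rho)=\infty$ let $\Psi(\rho)=\lim_{t\uparrow\rho}\Psi(t)$. Set $\nu=\Psi(\rho)$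 (so $\nu=0$ if and only if $\rho=0$). When $\nu=1$, $\sigma^2=\rho\Psi'(\rho)$, where $\Psi'(\rho)$ is understood as $\lim_{t\uparrow\rho}\Psi'(t)\in[0,\infty]$; equivalently $\sigma^2$ is the variance of the probability distribution $\pi(k)=w_k\rho^k/\Phi(\rho)$. The height $|v|$ of a node is its graph distance to the root; $\mathrm{ht}(t)=\max_v|v|$; $\mathrm{wid}(t)=\max_{k\ge0}|\{v\in t:|v|=k\}|$. ''$X_n\to\infty$ in probability'' means $\mathbf P\{X_n\ge K\}\to1$ for every $K$. *)

(* Defs.v *)
From HB Require Import structures.
From mathcomp Require Import all_boot all_order all_algebra.
From mathcomp Require Import all_classical all_reals all_analysis.
Import Order.TTheory GRing.Theory Num.Theory.
Import numFieldTopology.Exports numFieldNormedType.Exports.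

Set Implicit Arguments.
Unset Strict Implicit.
Unset Printing Implicit Defensive.

Local Open Scope classical_set_scope.
Local Open Scope ring_scope.

Inductive plane_tree := Node of seq plane_tree.

Definition children (t : plane_tree) : seq plane_tree := let: Node s := t in s.

Definition leaf : plane_tree := Node [::].

Fixpoint gentree_of (t : plane_tree) : GenTree.tree void :=
  let: Node s := t in GenTree.Node 0 (map gentree_of s).

Fixpoint of_gentree (g : GenTree.tree void) : plane_tree :=
  if g is GenTree.Node _ s then Node (map of_gentree s) else leaf.

Lemma gentree_ofK : cancel gentree_of of_gentree.
Proof.
rewrite /cancel; fix IH 1; case=> s /=; congr Node.
by elim: s => //= t s ->; rewrite IH.
Qed.

HB.instance Definition _ := Countable.copy plane_tree (can_type gentree_ofK).
HB.instance Definition _ := isPointed.Build plane_tree leaf.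
HB.instance Definition _ := @isMeasurable.Build default_measure_display
  plane_tree discrete_measurable discrete_measurable0
  discrete_measurableC discrete_measurableU.

(* Nodes are Ulam-Harris words: the root is [::], and i :: v is the node v of
   the subtree rooted at the i-th child of the root (counting from 0). *)
Fixpoint nodes (t : plane_tree) : seq (seq nat) :=
  let: Node s := t in
  [::] :: flatten [seq map (cons p.1) p.2 | p <- zip (iota 0 (size s)) (map nodes s)].

Fixpoint subtree (t : plane_tree) (v : seq nat) : plane_tree :=
  if v is i :: v' then subtree (nth leaf (children t) i) v' else t.

Definition degree (t : plane_tree) (v : seq nat) : nat :=
  size (children (subtree t v)).

Definition tree_size (t : plane_tree) : nat := size (nodes t).

(* The length of the word v is the graph distance of the node v to the root. *)
Definition height (t : plane_tree) : nat := (\max_(v <- nodes t) size v)%N.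

(* Levels k > height t are empty, so they do not affect the maximum. *)
Definition width (t : plane_tree) : nat :=
  (\max_(k < (height t).+1) count (fun v => size v == k) (nodes t))%N.

Section SimplyGenerated.
Context {R : realType}.
Implicit Types (w : nat -> R) (t : R).

Definition tree_weight w (t : plane_tree) : R :=
  \prod_(v <- nodes t) w (degree t v).

(* The index set is finite, so this is a genuine finite sum. *)
Definition partition_function w (n : nat) : R :=
  \sum_(t \in [set t | tree_size t = n]) tree_weight w t.

Definition is_simply_generated w (n : nat) d (Omega : measurableType d)
    (P : probability Omega R) (T : {RV P >-> plane_tree}) : Prop :=
  forall t : plane_tree, tree_size t = n ->
    P (T @^-1` [set t]) = (tree_weight w t / partition_function w n)%:E.

Definition Phi w t : \bar R := (\sum_(0 <= k <oo) (w k * t ^+ k)%:E)%E.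

(* Radius of convergence of Phi; the weights are non-negative. *)
Definition rho w : \bar R :=
  ereal_sup [set t%:E | t in [set t : R | 0 <= t /\ (Phi w t < +oo)%E]].

Definition Psi w t : \bar R :=
  ((\sum_(0 <= k <oo) (k%:R * w k * t ^+ k)%:E) / Phi w t)%E.

(* The filter of t tending to x from below, for an extended real x; the value
   at -oo plays no role. *)
Definition from_below (x : \bar R) : set_system R :=
  match x with
  | r%:E%E => r^'-
  | +oo%E => pinfty_nbhs R
  | -oo%E => ninfty_nbhs R
  end.

(* If rho = +oo, then Phi (rho) = +oo as soon as w k > 0 for some k >= 1, so
   that nu is then the limit of Psi. *)
Definition nu w : \bar R :=
  let Psi_lim := lim (Psi w t @[t --> from_below (rho w)]) in
  if rho w is r%:E%E then
    if (Phi w r < +oo)%E then Psi w r else Psi_lim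
  else Psi_lim.

(* Psi is finite on [0, rho[, where [fine] only changes its type. *)
Definition sigma2 w : \bar R :=
  (rho w *
   lim ((derive1 (fun t => fine (Psi w t)) t)%:E @[t --> from_below (rho w)]))%E.

End SimplyGenerated.

Section InProbability.
Context {R : realType} {d : nat -> measure_display}.
Context {Omega : forall n, measurableType (d n)}.
Variables (P : forall n, probability (Omega n) R) (F : set_system nat).

(* The n-th variable lives on its own probability space; F says how n tends
   to infinity. *)
Definition cvg0_in_probability (X : forall n, Omega n -> R) : Prop :=
  forall e : R, 0 < e -> P n [set x | e < `|X n x|] @[n --> F] --> 0%E.

Definition cvgy_in_probability (X : forall n, Omega n -> R) : Prop :=
  forall K : R, P n [set x | K <= X n x] @[n --> F] --> 1%E.

End InProbability.

(* Main.v *)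
Require Import Defs.
From HB Require Import structures.
From mathcomp Require Import all_boot all_order all_algebra.
From mathcomp Require Import all_classical all_reals all_analysis.
From mathcomp Require Import ring lra zify.
Import Order.TTheory GRing.Theory Num.Theory.
Import numFieldTopology.Exports numFieldNormedType.Exports.
Local Open Scope classical_set_scope.
Local Open Scope ring_scope.

(** Write [c] for the sequence of the degrees of the nodes of a tree of size
    [n], so that [sum c = n - 1].  Three facts carry the proof.

    1. The expected proportion of nodes at distance at least [h] from the root
    is the mean of [c_1 c_2 ... c_h], where [c] is a sequence of length [n] and
    sum [n - 1] drawn with weight [prod w(c_i)] ([deep_weightE]): the path to a
    marked node consists of [h] ancestors, each with a chosen child, and the
    cycle lemma counts what is left.  This mean decreases in [h], so it is at
    most twice its average over a binomial number of factors of mean [h / 2].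
    That average factorizes: it is the mean of [prod (1 + th (c_i - 1))] with
    [th = h / 2n] ([deep_weight_le_tilted]).  As the mean of the [c_i] is below
    1, the product is at most [exp (- Y / 16)], where [Y ^ 2] is [th ^ 2] times
    the sum of the [(c_i - 1) ^ 2], once [Y >= 1] ([prod_tilt_le]).

    2. For every [K], the sequences [c] for which this sum of squares is below
    [K n] have an exponentially small share of the total weight ([flat_rare]).
    If the radius of convergence [rho] is positive, [nu <= 1] means that
    [pi(k) = w_k rho^k / Phi(rho)] has mean at most 1.  Either [pi] has infinite
    variance, or its mean is below 1 and the missing mass of [c] has to come from
    large entries; in both cases Chernoff's bound for a bounded function of the
    entries applies.  It has to be compared with the total weight, whose rate of
    growth is [Phi(rho) / rho] ([powcoef_diag_growth]): otherwise the generating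
    function [T] of the trees, which satisfies [T(y) = y Phi(T(y))], would
    converge too far.  If [rho = 0], the total weight beats every exponential,
    while sequences with most of their mass in bounded entries do not.

    3. With [h = e sqrt(n)], facts 1 and 2 for a large [K] show that most nodes
    are at distance less than [h] from the root, so that some level has at least
    of the order of [n / h] nodes.  With [h = e sqrt(n) log^3 n], the expected
    number of nodes at distance [h] or more tends to 0, already for [K = 1]. *)

Set Implicit Arguments.
Unset Strict Implicit.
Unset Printing Implicit Defensive.

(** * Coefficients of powers of the weight generating function *)

Section PowerCoefficients.
Context {R : realFieldType}.
Implicit Types (w : nat -> R) (p q : {poly R}) (n N S B : nat).

Definition gf B w : {poly R} := \poly_(k < B) w k.

(** The coefficient of degree [S] of the [N]-th power of the full series of
    weights: terms of degree above [S] do not matter. *)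
Definition powcoef w N S : R := (gf S.+1 w ^+ N)`_S.

Definition lecoef p q := forall i, p`_i <= q`_i.

Lemma lecoef_refl p : lecoef p p. Proof. by []. Qed.

Lemma lecoefM p p' q q' : lecoef 0 p -> lecoef p p' -> lecoef 0 q ->
  lecoef q q' -> lecoef (p * q) (p' * q').
Proof.
move=> p0 pp' q0 qq' i; rewrite !coefM; apply: ler_sum => j _.
by have := p0 j; have := q0 (i - j)%N; rewrite !coef0 => ? ?; exact: ler_pM.
Qed.

Lemma lecoefM0 p q : lecoef 0 p -> lecoef 0 q -> lecoef 0 (p * q).
Proof.
move=> p0 q0 i; have := lecoefM (@lecoef_refl 0) p0 (@lecoef_refl 0) q0 i.
by rewrite mulr0.
Qed.

Lemma lecoef_exp0 p n : lecoef 0 p -> lecoef 0 (p ^+ n).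
Proof.
move=> p0; elim: n => [|n IH]; last by rewrite exprS; exact: lecoefM0.
by move=> i; rewrite expr0 coef0 coef1 ler0n.
Qed.

Lemma lecoef_exp p q n : lecoef 0 p -> lecoef p q -> lecoef (p ^+ n) (q ^+ n).
Proof.
move=> p0 pq; elim: n => [|n IH]; first by rewrite !expr0; exact: lecoef_refl.
by rewrite !exprS; apply: lecoefM => //; exact: lecoef_exp0.
Qed.

Lemma gf_ge0 B w : (forall k, 0 <= w k) -> lecoef 0 (gf B w).
Proof. by move=> w0 i; rewrite coef0 coef_poly; case: ifP. Qed.

Lemma gf_le B w w' : (forall k, w k <= w' k) -> lecoef (gf B w) (gf B w').
Proof. by move=> ww' i; rewrite !coef_poly; case: ifP. Qed.

Lemma coef_gfM B w p S : (S < B)%N ->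
  (gf B w * p)`_S = \sum_(k < S.+1) w k * p`_(S - k).
Proof.
move=> SB; rewrite coefM; apply: eq_bigr => k _.
by rewrite coef_poly (leq_trans _ SB)// ltn_ord.
Qed.

Lemma powcoefE B w N S : (S < B)%N -> (gf B w ^+ N)`_S = powcoef w N S.
Proof.
rewrite /powcoef; suff H N' S' B1 B2 : (S' < B1)%N -> (S' < B2)%N ->
    (gf B1 w ^+ N')`_S' = (gf B2 w ^+ N')`_S' by move=> SB; exact: H.
elim: N' S' => [|N' IH] S' h1 h2; first by rewrite !expr0.
rewrite !exprS !coef_gfM//; apply: eq_bigr => k _; congr (_ * _).
by apply: IH; rewrite (leq_ltn_trans (leq_subr _ _)).
Qed.

Lemma powcoef_rec w N S :
  powcoef w N.+1 S = \sum_(k < S.+1) w k * powcoef w N (S - k).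
Proof.
rewrite /powcoef exprS coef_gfM//; apply: eq_bigr => k _; congr (_ * _).
by rewrite powcoefE// ltnS leq_subr.
Qed.

Lemma powcoef0 w S : powcoef w 0 S = (S == 0%N)%:R.
Proof. by rewrite /powcoef expr0 coef1. Qed.

Lemma powcoef_ge0 w N S : (forall k, 0 <= w k) -> 0 <= powcoef w N S.
Proof.
by move=> w0; have := lecoef_exp0 N (gf_ge0 S.+1 w0) S; rewrite coef0.
Qed.

Lemma powcoefM_le w N N' S S' : (forall k, 0 <= w k) ->
  powcoef w N S * powcoef w N' S' <= powcoef w (N + N') (S + S').
Proof.
move=> w0; set B := (S + S').+1.
rewrite -(@powcoefE B w N S) ?ltnS ?leq_addr//.
rewrite -(@powcoefE B w N' S') ?ltnS ?leq_addl//.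
rewrite -(@powcoefE B w (N + N'))// exprD coefM.
have SB : (S < (S + S').+1)%N by rewrite ltnS leq_addr.
rewrite (bigD1 (Ordinal SB))//= addKn lerDl; apply: sumr_ge0 => j _.
have c0 M i : 0 <= (gf B w ^+ M)`_i.
  by have := lecoef_exp0 M (gf_ge0 B w0) i; rewrite coef0.
exact: mulr_ge0.
Qed.

(** Expanding the power of a polynomial, a coefficient is the total weight of
    the sequences with a given sum. *)
Lemma powcoef_sum B w N S : (S < B)%N ->
  powcoef w N S =
  \sum_(c : {ffun 'I_N -> 'I_B} | (\sum_i c i == S)%N) \prod_i w (c i).
Proof.
move=> SB; rewrite -(powcoefE w N SB) /gf poly_def.
rewrite -[N in _ ^+ N]card_ord -prodr_const.
rewrite (bigA_distr_bigA (fun (i : 'I_N) (j : 'I_B) => w j *: 'X^j)) coef_sum.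
rewrite [RHS]big_mkcond; apply: eq_bigr => c _.
rewrite scaler_prod prodrXr coefZ coefXn eq_sym.
by case: eqP => _; rewrite ?mulr1 ?mulr0.
Qed.

(** Exchangeability: in a sequence of length [N.+1] and sum [S], the average
    of the first entry is [S / N.+1].  Algebraically this is the derivative
    of a power. *)
Lemma powcoef_mean B w N S : (S < B)%N ->
  N.+1%:R * (gf B (fun k => k%:R * w k) * gf B w ^+ N)`_S =
  S%:R * powcoef w N.+1 S.
Proof.
move=> SB.
have gf'E : gf B (fun k => k%:R * w k) = 'X * (gf B w)^`().
  apply/polyP => -[|i]; rewrite coefXM coef_poly/= ?mul0r ?if_same//.
  by rewrite coef_deriv coef_poly; case: ifP; rewrite ?mul0rn// mulr_natl.
rewrite gf'E -mulrA mulr_natl -coefMn -mulrnAr -(deriv_exp _ N.+1) -(powcoefE _ _ SB).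
case: S SB => [|S] SB; first by rewrite coefXM mul0r.
by rewrite coefXM/= coef_deriv mulr_natl.
Qed.

(** A sequence of length [N.+1] and sum at most [N] has a zero among its
    [N.+1] entries. *)
Lemma powcoef_zero w N S : (forall k, 0 <= w k) -> (S <= N)%N ->
  powcoef w N.+1 S <= N.+1%:R * w 0%N * powcoef w N S.
Proof.
move=> w0 SN.
have := powcoef_mean w N (ltnSn S); set m := nth 0 _ S => mE.
have split0 : powcoef w N.+1 S <= w 0%N * powcoef w N S + m.
  rewrite /m powcoef_rec coef_gfM// !big_ord_recl/= subn0 mul0r mul0r add0r.
  rewrite lerD2l; apply: ler_sum => k _; rewrite /bump /= add1n.
  rewrite powcoefE ?ltnS ?leq_subr//; apply: ler_wpM2r; first exact: powcoef_ge0.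
  by rewrite ler_peMl// ler1n.
have SN' : S%:R <= N%:R :> R by rewrite ler_nat.
have a0 := powcoef_ge0 N.+1 S w0.
rewrite -mulrA; set b := _ * powcoef w N S in split0 *.
have Hm : N.+1%:R * m <= N%:R * powcoef w N.+1 S.
  by rewrite mE ler_wpM2r.
have := ler_wpM2l (ler0n R N.+1) split0; rewrite mulrDr => H.
have : N.+1%:R * powcoef w N.+1 S <= N.+1%:R * b + N%:R * powcoef w N.+1 S.
  by apply: le_trans H _; rewrite lerD2l.
by rewrite -[X in X * powcoef _ _ _ <= _]natr1 mulrDl mul1r addrC lerD2r.
Qed.

Lemma powcoef_add_zeros w N S : (forall k, 0 <= w k) ->
  w 0%N * powcoef w N S <= powcoef w N.+1 S.
Proof.
move=> w0; rewrite powcoef_rec big_ord_recl/= subn0 lerDl.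
by apply: sumr_ge0 => k _; rewrite mulr_ge0// powcoef_ge0.
Qed.

End PowerCoefficients.

(** * Plane trees, levels and forests *)

Definition deep_nodes (h : nat) (t : plane_tree) : nat :=
  count (fun v => (h <= size v)%N) (nodes t).

Lemma count_nodes_Node (b : pred nat) (s : seq plane_tree) :
  count (fun v => b (size v)) (nodes (Node s)) =
  (b 0%N + \sum_(t <- s) count (fun v => b (size v).+1) (nodes t))%N.
Proof.
rewrite /=; congr (_ + _)%N.
elim: s {1}0%N => [|t s IH] m; first by rewrite big_nil.
by rewrite /= count_cat IH big_cons count_map.
Qed.

Lemma tree_size_Node (s : seq plane_tree) :
  tree_size (Node s) = (\sum_(t <- s) tree_size t).+1.
Proof.
have sizeE t : tree_size t = count (fun v => predT (size v)) (nodes t).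
  exact: (esym (count_predT _)).
by rewrite sizeE count_nodes_Node add1n.
Qed.

Lemma deep_nodes0 (t : plane_tree) : deep_nodes 0 t = tree_size t.
Proof. exact: count_predT. Qed.

Lemma deep_nodesS (h : nat) (s : seq plane_tree) :
  deep_nodes h.+1 (Node s) = (\sum_(t <- s) deep_nodes h t)%N.
Proof. by rewrite /deep_nodes (count_nodes_Node (fun n => h < n)%N). Qed.

Lemma deep_nodes_le (h h' : nat) (t : plane_tree) :
  (h <= h')%N -> (deep_nodes h' t <= deep_nodes h t)%N.
Proof. by move=> hh'; apply: sub_count => v; exact: leq_trans. Qed.

(** The [h] lowest levels have at most [width t] nodes each. *)
Lemma tree_size_le_width (h : nat) (t : plane_tree) :
  (tree_size t <= h * width t + deep_nodes h t)%N.
Proof.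
have level_le k : (count (fun v => size v == k) (nodes t) <= width t)%N.
  have [kh|hk] := ltnP k (height t).+1.
    exact: (leq_bigmax (F := fun i : 'I_(height t).+1 =>
      count (fun v => size v == i) (nodes t)) (Ordinal kh)).
  rewrite (_ : count _ _ = 0)%N//; apply/eqP; rewrite -leqn0 leqNgt -has_count.
  apply/hasPn => v vt; rewrite neq_ltn (leq_ltn_trans _ hk)//.
  by apply: (leq_bigmax_seq (F := size)).
rewrite -deep_nodes0; elim: h => [|h IH]; first by rewrite mul0n.
apply: leq_trans IH _; rewrite mulSn addnAC addnC leq_add2r /deep_nodes.
rewrite (leq_trans _ (leq_add (level_le h) (leqnn _)))//.
rewrite -count_predUI; apply: leq_trans (leq_addr _ _).
by apply: sub_count => v /=; rewrite leq_eqVlt eq_sym.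
Qed.

Lemma deep_nodes_gt0 (h : nat) (t : plane_tree) :
  (0 < h <= height t)%N -> (0 < deep_nodes h t)%N.
Proof.
move=> /andP[h0 ht]; rewrite -has_count; apply: contraLR ht => /hasPn nh.
rewrite -ltnNge -(ltn_predK h0) ltnS; apply/bigmax_leqP_seq => v vt _.
by have := nh v vt; rewrite -ltnNge -{1}(ltn_predK h0) ltnS.
Qed.

(** Removing the root of its first tree turns a forest of [m.+1] trees with
    [N.+1] nodes into a forest of [k + m] trees with [N] nodes, where [k] is
    the degree of that root; conversely, [k] tells how many of these trees to put
    back under a root. *)
Fixpoint forests (N m : nat) : seq (seq plane_tree) :=
  match N, m with
  | 0, 0 => [:: [::]]
  | N'.+1, m'.+1 =>
      [seq Node (take k f) :: drop k f | k <- iota 0 N'.+1, f <- forests N' (k + m')]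
  | _, _ => [::]
  end.

Lemma forestsS (N m : nat) : forests N.+1 m.+1 =
  [seq Node (take k f) :: drop k f | k <- iota 0 N.+1, f <- forests N (k + m)].
Proof. by []. Qed.

Definition forest_size (f : seq plane_tree) : nat := (\sum_(t <- f) tree_size t)%N.

Lemma forest_size_Node (s f : seq plane_tree) :
  forest_size (Node s :: f) = (forest_size (s ++ f)).+1.
Proof. by rewrite /forest_size big_cons tree_size_Node big_cat addSn. Qed.

Lemma size_le_forest_size (f : seq plane_tree) : (size f <= forest_size f)%N.
Proof.
rewrite /forest_size -sum1_size leq_sum// => -[s] _.
by rewrite tree_size_Node.
Qed.

Lemma mem_forests (N m : nat) (f : seq plane_tree) :
  (f \in forests N m) = (size f == m) && (forest_size f == N).
Proof.
have size0 : forest_size [::] = 0%N by rewrite /forest_size big_nil.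
elim: N m f => [|N IH] [|m] f.
- by case: f => [|[s] f]; rewrite ?size0.
- by case: f => [|[s] f]; rewrite ?forest_size_Node ?andbF.
- by case: f => [|[s] f]; rewrite ?size0 ?forest_size_Node ?andbF.
rewrite forestsS; case: f => [|[s] f].
  by apply/negbTE/negP => /allpairsPdep[k [g []]].
rewrite forest_size_Node [size _]/= !eqSS; apply/allpairsPdep/idP.
  move=> [k [g [kN]]]; rewrite IH => /andP[/eqP sg /eqP gN] [-> ->].
  by rewrite cat_take_drop gN size_drop sg addKn !eqxx.
move=> /andP[/eqP sf /eqP fN]; exists (size s), (s ++ f).
rewrite take_size_cat// drop_size_cat// IH size_cat sf fN !eqxx; split => //.
rewrite mem_iota add0n/= ltnS -fN.
by apply: leq_trans (size_le_forest_size _); rewrite size_cat leq_addr.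
Qed.

Lemma forests_eq0 (N m : nat) : (N < m)%N -> forests N m = [::].
Proof.
move=> Nm; case E : (forests N m) => [//|f fs].
have : f \in forests N m by rewrite E mem_head.
rewrite mem_forests => /andP[/eqP sf /eqP fN].
by have := size_le_forest_size f; rewrite sf fN leqNgt Nm.
Qed.

Lemma uniq_forests (N m : nat) : uniq (forests N m).
Proof.
elim: N m => [|N IH] [|m]//.
rewrite forestsS; apply: allpairs_uniq_dep; [exact: iota_uniq|by []|].
move=> [k f] [k' f'] /allpairsPdep[i [g [_ gF [? ?]]]]; subst i g.
move=> /allpairsPdep[i [g [_ g'F [? ?]]]]; subst i g.
move: gF g'F; rewrite !mem_forests => /andP[/eqP sf _] /andP[/eqP sf' _] /= [tk dk].
have kk : k = k'.
  have := congr1 size tk; rewrite !size_take_min sf sf'.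
  by rewrite !(minn_idPl (leq_addr _ _)).
by subst k'; congr (existT _ _ _); rewrite -(cat_take_drop k f) tk dk cat_take_drop.
Qed.

Lemma perm_rot_forests (N m i : nat) :
  perm_eq [seq rot i f | f <- forests N m] (forests N m).
Proof.
have sub : {subset [seq rot i f | f <- forests N m] <= forests N m}.
  move=> _ /mapP[f fF ->]; move: fF; rewrite !mem_forests size_rot.
  by rewrite /forest_size (perm_big _ (permEl (perm_rot i f))).
have u : uniq [seq rot i f | f <- forests N m].
  by rewrite map_inj_uniq ?uniq_forests//; exact: rot_inj.
have [_ E] := uniq_min_size u sub (eq_leq (esym (size_map _ _))).
exact: uniq_perm (uniq_forests _ _) E.
Qed.

Definition trees (n : nat) : seq plane_tree :=
  [seq head leaf f | f <- forests n 1].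

Lemma forests1 (n : nat) (f : seq plane_tree) :
  f \in forests n 1 -> f = [:: head leaf f].
Proof. by rewrite mem_forests => /andP[+ _]; case: f => [|? []]. Qed.

Lemma uniq_trees (n : nat) : uniq (trees n).
Proof.
rewrite map_inj_in_uniq ?uniq_forests// => f g fF gF E.
by rewrite (forests1 fF) (forests1 gF) E.
Qed.

Lemma mem_trees (n : nat) (t : plane_tree) : (t \in trees n) = (tree_size t == n).
Proof.
apply/mapP/eqP => [[f fF ->]|tn].
  move: (fF); rewrite (forests1 fF) mem_forests /forest_size big_seq1.
  by move=> /andP[_ /eqP].
by exists [:: t] => //; rewrite mem_forests /forest_size big_seq1 tn !eqxx.
Qed.

(** * Weights of forests and of the deep nodes *)

Section Weights.
Context {R : realType}.
Implicit Types (w : nat -> R) (N m S h n : nat).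

Lemma tree_weight_Node w (s : seq plane_tree) :
  tree_weight w (Node s) = w (size s) * \prod_(t <- s) tree_weight w t.
Proof.
rewrite /tree_weight big_cons; congr (_ * _).
suff gen (s1 s2 : seq plane_tree) : \prod_(v <- flatten
    [seq map (cons p.1) p.2 | p <- zip (iota (size s1) (size s2)) (map nodes s2)])
    w (degree (Node (s1 ++ s2)) v) =
    \prod_(t <- s2) \prod_(v <- nodes t) w (degree t v) by exact: (gen [::] s).
elim: s2 s1 => [|t s2 IH] s1; first by rewrite !big_nil.
rewrite /= big_cat big_cons big_map/=; congr (_ * _).
  by apply: eq_bigr => v _; rewrite /degree /= nth_cat ltnn subnn.
by have := IH (rcons s1 t); rewrite size_rcons cat_rcons.
Qed.

Definition forest_weight w (f : seq plane_tree) : R :=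
  \prod_(t <- f) tree_weight w t.

Lemma big_forests (F : seq plane_tree -> R) m S :
  \sum_(f <- forests (m + S).+1 m.+1) F f =
  \sum_(k < S.+1) \sum_(f <- forests (m + S) (k + m))
    F (Node (take k f) :: drop k f).
Proof.
rewrite forestsS big_allpairs_dep.
rewrite -{1}[(m + S).+1]subn0 -/(index_iota 0 (m + S).+1).
rewrite (@big_cat_nat _ _ _ S.+1)//= ?ltnS ?leq_addl// big_mkord.
rewrite [X in _ + X]big1_seq ?addr0// => k /andP[_].
rewrite mem_index_iota => /andP[Sk _].
by rewrite forests_eq0 ?big_nil// [ltnRHS]addnC ltn_add2l.
Qed.

Lemma forest_weight_Node w k (f : seq plane_tree) : (k <= size f)%N ->
  forest_weight w (Node (take k f) :: drop k f) = w k * forest_weight w f.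
Proof.
move=> kf; rewrite /forest_weight big_cons tree_weight_Node size_takel//.
by rewrite -mulrA -big_cat cat_take_drop.
Qed.

(** The cycle lemma: among the sequences of length [N] and sum [N - m], the
    proportion [m / N] encodes forests of [m] trees.  Removing a root, the
    induction hypothesis gives the proportion [(m - 1 + c) / (N - 1)], with
    [c] the first entry, and [c] is [(N - m) / N] on average. *)
Lemma cycle_lemma w m S :
  (m + S)%:R * (\sum_(f <- forests (m + S) m) forest_weight w f) =
  m%:R * powcoef w (m + S) S.
Proof.
move NE : (m + S)%N => N; elim: N m S NE => [|N IH] [|m] S NE.
- by rewrite !mul0r.
- by [].
- by rewrite /= big_nil mulr0 mul0r.
move: NE; rewrite addSn => -[NE]; rewrite -NE big_forests NE.
have step : N%:R * (\sum_(k < S.+1) \sum_(f <- forests N (k + m))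
    forest_weight w (Node (take k f) :: drop k f)) =
    m%:R * powcoef w N.+1 S +
    (gf S.+1 (fun k => k%:R * w k) * gf S.+1 w ^+ N)`_S.
  rewrite powcoef_rec coef_gfM// !mulr_sumr -big_split; apply: eq_bigr => k _ /=.
  have kS : (k <= S)%N by rewrite -ltnS.
  rewrite powcoefE ?ltnS ?leq_subr//.
  transitivity (w k * ((k + m)%:R * powcoef w N (S - k))); last by rewrite natrD; ring.
  rewrite -(IH (k + m)%N (S - k)%N) -?NE; last by lia.
  rewrite mulrCA; congr (_ * _); rewrite mulr_sumr.
  rewrite big_seq [RHS]big_seq; apply: eq_bigr => f.
  rewrite mem_forests => /andP[/eqP sf _].
  by rewrite forest_weight_Node// sf leq_addr.
case: (eqVneq N 0%N) NE step => [->|N0] NE step.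
  move: NE => /eqP; rewrite addn_eq0 => /andP[/eqP -> /eqP ->].
  rewrite !big_ord_recl !big_ord0/= big_seq1 powcoef_rec big_ord_recl big_ord0.
  by rewrite powcoef0 /forest_weight big_seq1 tree_weight_Node big_nil !addr0.
apply: (@mulfI _ N%:R); first by rewrite pnatr_eq0.
rewrite mulrCA step mulrDr powcoef_mean// mulrA -mulrDl mulrA; congr (_ * _).
by rewrite -!natrM -natrD; congr (_%:R); lia.
Qed.

Definition deep_weight w h N m : R :=
  \sum_(f <- forests N m.+1) forest_weight w f * (deep_nodes h (head leaf f))%:R.

(** All the trees of a forest play the same role. *)
Lemma deep_weight_nth w h N m i : (i <= m)%N ->
  \sum_(f <- forests N m.+1) forest_weight w f * (deep_nodes h (nth leaf f i))%:R
  = deep_weight w h N m.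
Proof.
move=> im; rewrite /deep_weight -[RHS](perm_big _ (perm_rot_forests N m.+1 i)) big_map.
rewrite big_seq [RHS]big_seq; apply: eq_bigr => f.
rewrite mem_forests => /andP[/eqP sf _]; rewrite -nth0 [rot i f]/(_ ++ _) nth_cat size_drop sf.
rewrite subn_gt0 ltnS im nth_drop addn0; congr (_ * _).
by rewrite /forest_weight (perm_big _ (permEl (perm_rot i f))).
Qed.

(** A marked node at distance at least [h] from the root of the first tree has
    [h] ancestors, each with a chosen child: in terms of degrees, the first [h]
    entries [c] of a sequence get the additional weight [c].  Iterating the
    removal of the root leaves a marked node anywhere in the first tree of a
    forest, which the cycle lemma counts. *)
Lemma deep_weightE B w h m S : (S < B)%N -> (h <= m.+1 + S)%N ->
  deep_weight w h (m.+1 + S) m =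
  (gf B (fun k => k%:R * w k) ^+ h * gf B w ^+ (m.+1 + S - h))`_S.
Proof.
move=> SB; elim: h m S SB => [|h IH] m S SB hN.
  rewrite expr0 mul1r subn0 powcoefE//.
  apply: (@mulfI _ m.+1%:R); first by rewrite pnatr_eq0.
  rewrite -cycle_lemma.
  transitivity (\sum_(i < m.+1) \sum_(f <- forests (m.+1 + S) m.+1)
      forest_weight w f * (deep_nodes 0 (nth leaf f i))%:R).
    rewrite (eq_bigr (fun=> deep_weight w 0 (m.+1 + S) m)); last first.
      by move=> i _; rewrite deep_weight_nth// -ltnS.
    by rewrite sumr_const card_ord !mulr_natl.
  rewrite exchange_big mulr_sumr big_seq [RHS]big_seq; apply: eq_bigr => f.
  rewrite mem_forests => /andP[/eqP sf /eqP <-].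
  rewrite -mulr_sumr mulrC -natr_sum; congr (_%:R * _).
  rewrite /forest_size (big_nth leaf) sf big_mkord.
  by apply: eq_bigr => i _; rewrite deep_nodes0.
rewrite /deep_weight addSn big_forests exprS -mulrA subSS coef_gfM//.
apply: eq_bigr => k _; have kS : (k <= S)%N by rewrite -ltnS.
case: (posnP k) => [->|k0].
  rewrite !mul0r big1_seq// => f _.
  by rewrite take0 /= deep_nodesS big_nil mulr0.
have kmE : (k + m)%N = (k + m).-1.+1 by rewrite prednK// addn_gt0 k0.
have NE : (m + S)%N = ((k + m).-1.+1 + (S - k))%N by lia.
rewrite {2}NE -IH -?NE; last 2 first.
- exact: leq_ltn_trans (leq_subr _ _) SB.
- by rewrite addSn ltnS in hN.
transitivity (\sum_(i < k) w k * deep_weight w h (m + S) (k + m).-1); last first.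
  by rewrite sumr_const card_ord -mulrA mulr_natl.
rewrite kmE; transitivity (\sum_(i < k) \sum_(f <- forests (m + S) (k + m).-1.+1)
    w k * (forest_weight w f * (deep_nodes h (nth leaf f i))%:R)).
  rewrite exchange_big big_seq [RHS]big_seq; apply: eq_bigr => f.
  rewrite -kmE mem_forests => /andP[/eqP sf _].
  rewrite forest_weight_Node ?sf ?leq_addr//= deep_nodesS -!mulr_sumr mulrA.
  congr (_ * _); rewrite natr_sum (big_nth leaf) big_mkord.
  rewrite size_takel ?sf ?leq_addr//; apply: eq_bigr => i _.
  by rewrite nth_take.
apply: eq_bigr => i _; rewrite -mulr_sumr deep_weight_nth//.
by rewrite -ltnS -kmE (leq_trans (ltn_ord i))// leq_addr.
Qed.

Lemma big_trees w n (F : plane_tree -> R) :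
  \sum_(t <- trees n) tree_weight w t * F t =
  \sum_(f <- forests n 1) forest_weight w f * F (head leaf f).
Proof.
rewrite big_map big_seq [RHS]big_seq; apply: eq_bigr => f fF.
by rewrite [in RHS](forests1 fF) /forest_weight big_seq1.
Qed.

Lemma partition_function_trees w n :
  partition_function w n = \sum_(t <- trees n) tree_weight w t.
Proof.
have tE : [set t | tree_size t = n] = [set` trees n].
  by apply/seteqP; split => t /=; rewrite mem_trees => /eqP.
by rewrite /partition_function tE -fsbig_seq ?uniq_trees.
Qed.

Lemma partition_functionE w n :
  partition_function w n = \sum_(f <- forests n 1) forest_weight w f.
Proof.
have := big_trees w n (fun=> 1); rewrite partition_function_trees.
by under eq_bigr do rewrite mulr1; under [in RHS]eq_bigr do rewrite mulr1.
Qed.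

End Weights.

(** * The depth of a uniformly random node *)

Section DepthBound.
Context {R : realType}.
Implicit Types (w : nat -> R) (n h : nat) (th : R).

Lemma deep_weight_ge0 w h N m : (forall k, 0 <= w k) -> 0 <= deep_weight w h N m.
Proof.
move=> w0; apply: sumr_ge0 => f _; rewrite mulr_ge0 ?ler0n//.
by apply: prodr_ge0 => t _; exact: prodr_ge0.
Qed.

Lemma deep_weight_le w h h' N m : (forall k, 0 <= w k) -> (h <= h')%N ->
  deep_weight w h' N m <= deep_weight w h N m.
Proof.
move=> w0 hh'; apply: ler_sum => f _; apply: ler_wpM2l.
  by apply: prodr_ge0 => t _; exact: prodr_ge0.
by rewrite ler_nat deep_nodes_le.
Qed.

(** The derivative at 1 of [(1 - th + th X) ^ n]. *)
Lemma binomial_mean n th :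
  \sum_(i < n.+1) (1 - th) ^+ (n - i) * th ^+ i *+ 'C(n, i) * i%:R = n%:R * th.
Proof.
pose p : {poly R} := (1 - th)%:P + th%:P * 'X.
have E : p ^+ n = \sum_(i < n.+1) ((1 - th) ^+ (n - i) * th ^+ i *+ 'C(n, i)) *: 'X^i.
  rewrite exprDn; apply: eq_bigr => i _.
  by rewrite exprMn -!polyC_exp mulrA -polyCM mul_polyC scalerMnl.
have := congr1 (fun q => (q^`()).[1]) E.
rewrite deriv_exp linear_sum horner_sum => H.
transitivity (p^`().[1] * p.[1] ^+ n.-1 *+ n); last first.
  have -> : p.[1] = 1 by rewrite !hornerE subrK.
  have -> : p^`() = th%:P by rewrite derivD derivC add0r deriv_mulC derivX mulr1.
  by rewrite hornerC expr1n mulr1 mulr_natl.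
rewrite -horner_exp -hornerM -hornerMn H; apply: eq_bigr => i _ /=.
by rewrite derivZ derivXn hornerZ hornerMn hornerXn expr1n.
Qed.

Lemma binomial_mass n th :
  \sum_(i < n.+1) (1 - th) ^+ (n - i) * th ^+ i *+ 'C(n, i) = 1.
Proof. by rewrite -exprDn subrK expr1n. Qed.

(** With [A_i] the total weight of the trees with a marked node at distance at
    least [i] from the root, the right-hand side is twice the mean of [A_N],
    with [N] binomial of mean [n th = h / 2].  As [A] decreases,
    [A_i >= A_h (1 - i / h)] for every [i].  The tilted weights make the sum
    over degree sequences a product over the entries. *)
Lemma deep_weight_le_tilted w h n : (forall k, 0 <= w k) -> (0 < h <= n)%N ->
  deep_weight w h n 0 <=
  2 * powcoef (fun k => w k * (1 + h%:R / (2 * n%:R) * (k%:R - 1))) n n.-1.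
Proof.
move=> w0 /andP[h0 hn]; set th : R := h%:R / _.
have n0 : (0 < n)%N := leq_trans h0 hn.
have nR : 0 < n%:R :> R by rewrite ltr0n.
have hR : 0 < h%:R :> R by rewrite ltr0n.
have th0 : 0 <= th by rewrite divr_ge0// mulr_ge0// ltW.
have th1 : th <= 1.
  have : h%:R <= n%:R :> R by rewrite ler_nat.
  by rewrite ler_pdivrMr ?mulr_gt0//; lra.
pose b i : R := (1 - th) ^+ (n - i) * th ^+ i *+ 'C(n, i).
have b0 i : 0 <= b i by rewrite mulrn_wge0// mulr_ge0// exprn_ge0// subr_ge0.
have mix : powcoef (fun k => w k * (1 + th * (k%:R - 1))) n n.-1 =
    \sum_(i < n.+1) b i * deep_weight w i n 0.
  rewrite -(@powcoefE _ n) ?prednK//.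
  have -> : gf n (fun k => w k * (1 + th * (k%:R - 1))) =
      (1 - th)%:P * gf n w + th%:P * gf n (fun k => k%:R * w k).
    apply/polyP => i; rewrite coefD !coefCM !coef_poly; case: ifP => _; last first.
      by rewrite !mulr0 addr0.
    ring.
  rewrite exprDn coef_sum; apply: eq_bigr => i _.
  have in' : (i <= n)%N by rewrite -ltnS.
  have := @deep_weightE _ n w i 0 n.-1; rewrite add1n prednK// leqnn => ->//.
  rewrite !exprMn -!polyC_exp mulrACA -polyCM -mulrnAl -polyCMn coefCM.
  by congr (_ * nth 0 (polyseq _) _); rewrite mulrC.
rewrite mix; set A := deep_weight w h n 0.
have A0 : 0 <= A by exact: deep_weight_ge0.
have low i : A * (1 - i%:R / h%:R) <= deep_weight w i n 0.
  have [ih|hi] := leqP i h.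
    apply: le_trans (deep_weight_le n 0 w0 ih).
    by rewrite ler_piMr// gerBl divr_ge0// ltW.
  apply: (@le_trans _ _ 0); last exact: deep_weight_ge0.
  by rewrite mulr_ge0_le0// subr_le0 ler_pdivlMr// mul1r ler_nat ltnW.
clearbody A.
have : \sum_(i < n.+1) b i * (A * (1 - i%:R / h%:R)) <=
    \sum_(i < n.+1) b i * deep_weight w i n 0.
  by apply: ler_sum => i _; exact: ler_wpM2l.
have -> : \sum_(i < n.+1) b i * (A * (1 - i%:R / h%:R)) =
    A * (\sum_(i < n.+1) b i - (\sum_(i < n.+1) b i * i%:R) / h%:R).
  rewrite mulrBr mulr_suml !mulr_sumr -sumrB; apply: eq_bigr => i _; ring.
rewrite binomial_mass binomial_mean /th.
have -> : 1 - n%:R * (h%:R / (2 * n%:R)) / h%:R = 1 / 2 :> R.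
  by field; rewrite !gt_eqF.
by lra.
Qed.

Lemma expR_ge_sqr (u : R) : -2 <= u -> (1 + u / 2) ^+ 2 <= expR u.
Proof.
move=> u2; rewrite [in leRHS](_ : u = u / 2 * 2%:R); last by rewrite divfK.
rewrite expRM_natr.
by rewrite ler_pXn2r// ?nnegrE ?expR_ge0 ?expR_ge1Dx//; lra.
Qed.

(** A quantitative form of [1 + x <= exp x], from [(1 + u / 2) ^ 2 <= exp u] with
    [u] the exponent below. *)
Lemma expR_ge1Dx_sqr (s x : R) : -1 <= x -> x <= s -> 0 <= s ->
  1 + x <= expR (x - x ^+ 2 / (8 * (1 + s))).
Proof.
move=> x1 xs s0; set a := (8 * (1 + s))^-1.
have a0 : 0 < a by rewrite invr_gt0; lra.
have aE : a * (8 * (1 + s)) = 1 by rewrite mulVf// gt_eqF//; lra.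
have a8 : a <= 1 / 8 by nra.
have ax : a * x <= 1 / 8 by nra.
have ax' : - (1 / 8) <= a * x by nra.
rewrite -[_ / _]/(_ * a) (_ : x - x ^+ 2 * a = x * (1 - a * x)); last by ring.
apply: le_trans (expR_ge_sqr _); last by nra.
rewrite (_ : (1 + x * (1 - a * x) / 2) ^+ 2 =
  1 + x + x ^+ 2 * ((1 - a * x) ^+ 2 / 4 - a)); last by field.
rewrite lerDl mulr_ge0 ?sqr_ge0//.
have : 7 / 8 <= 1 - a * x by lra.
by move: (1 - a * x) => t; nra.
Qed.

(** When the entries of [c] have mean below 1, the sum of the squares
    [(c_i - 1)^2] forces the product down; it enters with a square root because
    the bound [s] on the terms is only the root of their sum of squares. *)
Lemma prod_tilt_le n (c : 'I_n -> nat) th Y : (0 < n)%N ->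
  (\sum_i c i = n.-1)%N -> 0 <= th <= 1 -> 1 <= Y ->
  Y <= th ^+ 2 * (\sum_i ((c i)%:R - 1) ^+ 2) ->
  \prod_i (1 + th * ((c i)%:R - 1)) <= expR (- Num.sqrt Y / 16).
Proof.
move=> n0 sumc /andP[th0 th1] Y1; set X := \sum_i _ => YX.
set Z := th ^+ 2 * X in YX; pose s := Num.sqrt Z.
have Z1 : 1 <= Z by exact: le_trans YX.
have s1 : 1 <= s by rewrite -sqrtr1 ler_wsqrtr.
have sZ : s ^+ 2 = Z by rewrite sqr_sqrtr//; lra.
have xlo i : -1 <= th * ((c i)%:R - 1).
  by have : 0 <= (c i)%:R :> R by []; nra.
have xhi i : th * ((c i)%:R - 1) <= s.
  apply: le_trans (ler_norm _) _; rewrite -sqrtr_sqr ler_wsqrtr//.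
  rewrite /Z /X (bigD1 i)//= [in leRHS]mulrDr exprMn lerDl mulr_ge0 ?sqr_ge0//.
  by apply: sumr_ge0 => j _; exact: sqr_ge0.
set a := 8 * (1 + s).
have a0 : 0 < a by rewrite /a; lra.
have step : \prod_i (1 + th * ((c i)%:R - 1)) <=
    \prod_i expR (th * ((c i)%:R - 1) - (th * ((c i)%:R - 1)) ^+ 2 / a).
  apply: ler_prod => i _; rewrite expR_ge1Dx_sqr//; last by lra.
  by rewrite andbT; have := xlo i; lra.
apply: le_trans step _; rewrite -expR_sum ler_expR sumrB -mulr_suml.
have -> : \sum_i (th * ((c i)%:R - 1)) ^+ 2 = Z.
  by rewrite /Z /X mulr_sumr; apply: eq_bigr => i _; rewrite exprMn.
rewrite -mulr_sumr sumrB -natr_sum sumc sumr_const card_ord.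
have -> : n.-1%:R - 1 *+ n = -1 :> R by rewrite -{2}(prednK n0) -natr1; ring.
have : Num.sqrt Y <= s by rewrite ler_wsqrtr.
have : s / 16 <= Z / a by rewrite -sZ ler_pdivlMr// /a; nra.
by lra.
Qed.

End DepthBound.

(** * Exponential growth of the partition function *)

Section Growth.
Context {R : realType}.
Variable w : nat -> R.
Hypothesis w_ge0 : forall k, 0 <= w k.
Hypothesis w0_gt0 : 0 < w 0%N.
Implicit Types (N m n k K : nat).

Definition forests_weight N m : R := \sum_(f <- forests N m) forest_weight w f.

Lemma forest_weight_ge0 (f : seq plane_tree) : 0 <= forest_weight w f.
Proof. by apply: prodr_ge0 => t _; exact: prodr_ge0. Qed.

Lemma forests_weight_ge0 N m : 0 <= forests_weight N m.
Proof. by apply: sumr_ge0 => f _; exact: forest_weight_ge0. Qed.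

(** Splitting off the first tree, sorted by its size. *)
Lemma forests_weight_conv N m :
  \sum_(i < N.+1) forests_weight i 1 * forests_weight (N - i) m <=
  forests_weight N m.+1.
Proof.
pose hs (f : seq plane_tree) := tree_size (head leaf f).
have part (i : 'I_N.+1) : forests_weight i 1 * forests_weight (N - i) m =
    \sum_(f <- forests N m.+1 | hs f == i) forest_weight w f.
  rewrite -big_filter.
  rewrite (perm_big [seq g ++ f | g <- forests i 1, f <- forests (N - i) m]).
    rewrite big_allpairs_dep/= mulr_suml; apply: eq_bigr => g _.
    rewrite mulr_sumr; apply: eq_bigr => f _.
    by rewrite /forest_weight big_cat.
  apply: uniq_perm; first by rewrite filter_uniq// uniq_forests.
    apply: allpairs_uniq; rewrite ?uniq_forests// => p q.
    move=> /allpairsP[[g f] [/= gF _ ->]] /allpairsP[[g' f'] [/= g'F _ ->]].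
    move: gF g'F; rewrite !mem_forests /=.
    move=> /andP[/eqP sg _] /andP[/eqP sg' _] /eqP.
    by rewrite eqseq_cat ?sg ?sg'// => /andP[/eqP -> /eqP ->].
  move=> f; rewrite mem_filter; apply/andP/allpairsP => /=.
    rewrite mem_forests => -[/eqP hf /andP[]]; case: f hf => // t f.
    rewrite /hs /= eqSS => hf sf /eqP fN; exists ([:: t], f); split => //.
      by rewrite mem_forests /forest_size big_seq1 hf !eqxx.
    rewrite mem_forests sf/= -hf -fN /forest_size big_cons.
    by rewrite addKn.
  move=> [[g g'] [/= gF g'F ->]]; move: gF g'F; rewrite !mem_forests.
  move=> /andP[sg /eqP gi] /andP[/eqP sg' /eqP g'N].
  case: g sg gi => // t [|//] _; rewrite /forest_size big_seq1 => ti.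
  rewrite /hs /= ti eqxx sg' eqxx big_cons ti -/(forest_size g') g'N.
  by rewrite subnKC ?eqxx// -ltnS.
rewrite (eq_bigr _ (fun i _ => part i)) (exchange_big_dep xpredT)//= /forests_weight.
rewrite big_seq [leRHS]big_seq; apply: ler_sum => f fF.
have fN : (hs f < N.+1)%N.
  move: fF; rewrite mem_forests ltnS => /andP[+ /eqP <-]; case: f => // t f _.
  by rewrite /hs /forest_size big_cons leq_addr.
by rewrite (big_pred1 (Ordinal fN)).
Qed.

Lemma coef_exp_le_forests_weight B k n :
  (gf B (fun n => forests_weight n 1) ^+ k)`_n <= forests_weight n k.
Proof.
elim: k n => [|k IH] n.
  rewrite expr0 coef1; case: n => [|n]; last exact: forests_weight_ge0.
  by rewrite /forests_weight big_seq1 /forest_weight big_nil.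
apply: le_trans (forests_weight_conv n k); rewrite exprS coefM.
apply: ler_sum => i _; apply: ler_pM => //.
- by rewrite coef_poly; case: ifP => // _; exact: forests_weight_ge0.
- have := lecoef_exp0 k (gf_ge0 B (fun n => forests_weight_ge0 n 1)) (n - i)%N.
  by rewrite coef0.
- by rewrite coef_poly; case: ifP => // _; exact: forests_weight_ge0.
Qed.

Lemma forests_weight1S n :
  forests_weight n.+1 1 = \sum_(k < n.+1) w k * forests_weight n k.
Proof.
rewrite /forests_weight (big_forests _ 0 n); apply: eq_bigr => k _.
rewrite addn0 mulr_sumr big_seq [RHS]big_seq; apply: eq_bigr => f.
by rewrite mem_forests add0n => /andP[/eqP sf _]; rewrite forest_weight_Node ?sf.
Qed.

Lemma forests_weight1_le n : forests_weight n.+1 1 <= w 0%N * powcoef w n n.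
Proof.
have := cycle_lemma w 1 n; rewrite add1n mul1r -/(forests_weight _ _) => E.
have n0 : 0 < n.+1%:R :> R by rewrite ltr0n.
by rewrite -(ler_pM2l n0) E mulrA powcoef_zero.
Qed.

(** If the diagonal coefficients grew at a rate at most [kap'], the generating
    function [T] of the trees would converge at a point [y > 1 / kap].  Then
    [tau := T y] satisfies [y * Phi tau <= tau], against the hypothesis. *)
Lemma powcoef_diag_large (kap' kap : R) : 0 < kap' < kap ->
  (forall t : R, 0 < t -> exists K, kap * t <= \sum_(k < K) w k * t ^+ k) ->
  exists2 n, (0 < n)%N & kap' ^+ n <= powcoef w n n.
Proof.
move=> /andP[k'0 k'k] hkap; apply: contrapT => /forall2NP small.
have diag n : powcoef w n n <= kap' ^+ n.
  case: n => [|n]; first by rewrite powcoef0 expr0.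
  by case: (small n.+1) => // /negP; rewrite -ltNge => /ltW.
pose y := 2 / (kap' + kap).
have y0 : 0 < y by rewrite divr_gt0//; lra.
have yE : y * (kap' + kap) = 2 by rewrite divfK// gt_eqF//; lra.
clearbody y; have k'y : kap' * y < 1 by nra.
have ky : 1 < kap * y by nra.
pose Z n := forests_weight n 1.
have Z0 n : 0 <= Z n by exact: forests_weight_ge0.
pose T : R^nat := fun N => \sum_(n < N) Z n * y ^+ n.
have T_ge0 N : 0 <= T N by apply: sumr_ge0 => n _; rewrite mulr_ge0// exprn_ge0// ltW.
have TS : nondecreasing_seq T.
  apply/nondecreasing_seqP => N; rewrite /T big_ord_recr/= lerDl.
  by rewrite mulr_ge0// exprn_ge0// ltW.
pose M := w 0%N * y / (1 - kap' * y).
have TM N : T N <= M.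
  apply: (@le_trans _ _ (T N.+1)); first exact: TS.
  rewrite /T big_ord_recl /= /Z /forests_weight big_nil mul0r add0r.
  apply: (@le_trans _ _ (\sum_(i < N) w 0%N * y * (kap' * y) ^+ i)).
    apply: ler_sum => i _; rewrite /bump leq0n add1n.
    have -> : w 0%N * y * (kap' * y) ^+ i = w 0%N * kap' ^+ i * y ^+ i.+1.
      by rewrite exprS exprMn; ring.
    rewrite ler_wpM2r ?exprn_ge0//; first exact: ltW.
    apply: le_trans (forests_weight1_le _) _.
    by rewrite ler_wpM2l ?diag// ltW.
  rewrite -mulr_sumr ler_wpM2l ?mulr_ge0//; first exact: ltW.
  have := subrX1 (kap' * y) N; have : 0 <= (kap' * y) ^+ N.
    by rewrite exprn_ge0// mulr_ge0// ltW.
  set z := kap' * y; move: (\sum_(i < N) z ^+ i) => u z0 zE.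
  by rewrite -[leRHS]mul1r ler_pdivlMr ?subr_gt0//; rewrite -/z in k'y *; nra.
have cvgT : cvgn T.
  apply: nondecreasing_is_cvgn => //; exists M => _ [N _ <-]; exact: TM.
pose tau := limn T.
have Ttau N : T N <= tau by exact: nondecreasing_cvgn_le.
have tau0 : 0 < tau.
  apply: lt_le_trans (Ttau 2); rewrite /T big_ord_recr big_ord1/= expr0 mulr1 expr1.
  rewrite ltr_wpDl// mulr_gt0// /Z forests_weight1S big_ord1 mulr_gt0//.
  by rewrite /forests_weight big_seq1 /forest_weight big_nil.
have fix_le K N : y * (\sum_(k < K) w k * T N ^+ k) <= tau.
  pose p : {poly R} := 'X * \sum_(k < K) w k *: gf N Z ^+ k.
  have pE : p.[y] = y * (\sum_(k < K) w k * T N ^+ k).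
    rewrite hornerM hornerX horner_sum; congr (_ * _); apply: eq_bigr => k _.
    by rewrite hornerZ horner_exp horner_poly.
  rewrite -pE horner_coef; apply: le_trans (Ttau (size p)).
  apply: ler_sum => n _; rewrite ler_wpM2r ?exprn_ge0//; first exact: ltW.
  rewrite coefXM; case: {n}(n : nat) => [|n]//=; rewrite coef_sum /Z forests_weight1S.
  have low k : (w k *: gf N Z ^+ k)`_n <= w k * forests_weight n k.
    by rewrite coefZ ler_wpM2l ?coef_exp_le_forests_weight.
  have w0' k : 0 <= w k * forests_weight n k by rewrite mulr_ge0 ?forests_weight_ge0.
  apply: (@le_trans _ _ (\sum_(k < K) w k * forests_weight n k)); first exact: ler_sum.
  rewrite -(big_mkord xpredT (fun k => w k * forests_weight n k)).
  rewrite -(big_mkord xpredT (fun k => w k * forests_weight n k)).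
  have [Kn|nK] := leqP K n.+1.
    by rewrite (@big_cat_nat _ _ _ K 0 n.+1)//= lerDl sumr_ge0.
  rewrite (@big_cat_nat _ _ _ n.+1 0 K)//= 1?ltnW// [X in _ + X]big1_seq ?addr0// => k.
  rewrite mem_index_iota => /andP[_ /andP[nk _]].
  by rewrite /forests_weight forests_eq0// big_nil mulr0.
have [K hK] := hkap _ tau0.
have : y * (\sum_(k < K) w k * tau ^+ k) <= tau.
  have gfE x : (gf K w).[x] = \sum_(k < K) w k * x ^+ k by rewrite horner_poly.
  have cv : y * (gf K w).[T N] @[N --> \oo] --> y * (gf K w).[tau].
    apply: cvgM; first exact: cvg_cst.
    by apply: (continuous_cvg _ (@continuous_horner _ (gf K w) tau)).
  rewrite -gfE; apply: (cvgr_to_le cv); near=> N; rewrite gfE.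
  exact: fix_le.
have := ler_wpM2l (ltW y0) hK; nra.
Unshelve. all: by end_near. Qed.

Lemma powcoef_diagX n q : powcoef w n n ^+ q <= powcoef w (q * n) (q * n).
Proof.
elim: q => [|q IH]; first by rewrite mul0n powcoef0.
rewrite exprS mulSn; apply: le_trans (powcoefM_le _ _ _ _ w_ge0).
by rewrite ler_wpM2l// powcoef_ge0.
Qed.

(** The diagonal coefficients are supermultiplicative, so the bound at one
    index propagates along each residue class on which they do not vanish. *)
Lemma powcoef_diag_growth (kap' kap : R) : 0 < kap' < kap ->
  (forall t : R, 0 < t -> exists K, kap * t <= \sum_(k < K) w k * t ^+ k) ->
  exists2 c : R, 0 < c &
    forall n, 0 < powcoef w n n -> c * kap' ^+ n <= powcoef w n n.
Proof.
move=> kk hkap; have [n0 n0_gt0 hn0] := powcoef_diag_large kk hkap.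
have k'0 : 0 < kap' by case/andP: kk.
have class r : exists2 c : R, 0 < c & forall n, (n %% n0 = r)%N ->
    0 < powcoef w n n -> c * kap' ^+ n <= powcoef w n n.
  pose p n := ((n %% n0)%N == r) && (0 < powcoef w n n).
  have [ex_p|none] := pselect (exists n, p n); last first.
    by exists 1 => // n nr n_gt0; case: none; exists n; rewrite /p nr eqxx.
  have [m /andP[/eqP mr m_gt0] mmin] := ex_minnP ex_p.
  exists (powcoef w m m / kap' ^+ m); first by rewrite divr_gt0// exprn_gt0.
  move=> n nr n_gt0; have mn : (m <= n)%N by apply: mmin; rewrite /p nr eqxx.
  have -> : n = (m + (n - m) %/ n0 * n0)%N.
    rewrite divnK ?subnKC// -/(n0 %| n - m)%N.
    by rewrite -(eqn_mod_dvd _ mn) mr nr.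
  apply: le_trans (powcoefM_le _ _ _ _ w_ge0).
  rewrite exprD mulrA divfK ?gt_eqF ?exprn_gt0//; apply: ler_wpM2l; first exact: ltW.
  apply: le_trans (powcoef_diagX _ _); rewrite mulnC exprM.
  by apply: lerXn2r; rewrite ?nnegrE ?powcoef_ge0// exprn_ge0// ltW.
have upto r : exists2 c : R, 0 < c & forall n, (n %% n0 < r)%N ->
    0 < powcoef w n n -> c * kap' ^+ n <= powcoef w n n.
  elim: r => [|r [c1 c1_gt0 h1]]; first by exists 1.
  have [c2 c2_gt0 h2] := class r.
  exists (Num.min c1 c2); first by rewrite lt_min c1_gt0.
  move=> n; rewrite ltnS leq_eqVlt => /orP[/eqP|] nr n_gt0.
    apply: le_trans (h2 _ nr n_gt0).
    by rewrite ler_wpM2r ?exprn_ge0 ?ge_min ?lexx ?orbT// ltW.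
  apply: le_trans (h1 _ nr n_gt0).
  by rewrite ler_wpM2r ?exprn_ge0 ?ge_min ?lexx// ltW.
by have [c c0 h] := upto n0; exists c => // n; apply: h; rewrite ltn_mod.
Qed.

End Growth.

(** * Degree sequences with small second moment are exponentially rare *)

Section RareSequences.
Context {R : realType}.
Implicit Types (w g : nat -> R) (K : R) (n N S M : nat).

Definition second_moment n (c : 'I_n -> nat) : R := \sum_i ((c i)%:R - 1) ^+ 2.

Definition flat_weight w K n : R :=
  \sum_(c : {ffun 'I_n -> 'I_n} | ((\sum_i c i)%N == n.-1) &&
      (second_moment (fun i => c i : nat) < K * n%:R)) \prod_i w (c i).

(** Exponentially small relative to the total weight, so that the bound survives
    a union over the [n] nodes. *)
Definition flat_rare w K := exists D r : R, [/\ 0 <= D, 0 <= r < 1 &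
  forall n, (0 < n)%N -> 0 < powcoef w n n.-1 ->
    flat_weight w K n <= D * r ^+ n * powcoef w n n.-1].

(** Large entries are sent to 0 rather than to [M]: their mass disappears. *)
Definition trunc M (k : nat) : nat := if (k <= M)%N then k else 0%N.

(** When the second moment is small, the large entries carry little mass. *)
Lemma flat_trunc_mass K M n (c : 'I_n -> nat) : (0 < M)%N -> (0 < n)%N ->
  (\sum_i c i = n.-1)%N -> second_moment c < K * n%:R ->
  n%:R - 1 - 2 * K / M%:R * n%:R <= (\sum_i trunc M (c i))%:R :> R.
Proof.
move=> M0 n0 sumc X.
have MR : 0 < M%:R :> R by rewrite ltr0n.
have term (k : nat) : k%:R <= (trunc M k)%:R + 2 / M%:R * (k%:R - 1) ^+ 2 :> R.
  rewrite /trunc; case: leqP => Mk.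
    by rewrite lerDl mulr_ge0 ?sqr_ge0// divr_ge0// ltW.
  rewrite add0r mulrAC ler_pdivlMr//.
  have : M%:R + 1 <= k%:R :> R by rewrite natr1 ler_nat.
  have : 1 <= M%:R :> R by rewrite ler1n.
  by move: (M%:R : R) (k%:R : R) => a b; nra.
have : (\sum_i c i)%:R <= (\sum_i trunc M (c i))%:R + 2 / M%:R * second_moment c :> R.
  by rewrite !natr_sum mulr_sumr -big_split; apply: ler_sum => i _; exact: term.
rewrite sumc -(ltr_pM2l (divr_gt0 (ltr0n R 2) MR)) in X *.
have -> : n.-1%:R = n%:R - 1 :> R by rewrite -[in RHS](prednK n0) -natr1 addrK.
by move: X; rewrite !mulrA (mulrAC 2 _ K); lra.
Qed.

(** The exponential moment method, with a general multiplicative weight. *)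
Lemma flat_weight_le_tilted w g K n (C : R) : (0 < n)%N ->
  (forall k, 0 <= w k) -> (forall k, 0 <= g k) -> 0 <= C ->
  (forall c : 'I_n -> nat, (\sum_i c i = n.-1)%N ->
    second_moment c < K * n%:R -> 1 <= C * \prod_i g (c i)) ->
  flat_weight w K n <= C * powcoef (fun k => w k * g k) n n.-1.
Proof.
move=> n0 w0 g0 C0 Cg; rewrite (@powcoef_sum _ n) ?prednK// mulr_sumr.
rewrite /flat_weight big_mkcondr; apply: ler_sum => c /eqP sumc.
have p0 : 0 <= \prod_i w (c i) by apply: prodr_ge0.
rewrite big_split/= mulrCA; case: ifP => [X|_].
  by rewrite ler_peMr// Cg.
by rewrite !mulr_ge0// prodr_ge0.
Qed.

Lemma powcoef_le_horner w N S (x : R) : (forall k, 0 <= w k) -> 0 <= x ->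
  powcoef w N S * x ^+ S <= (\sum_(k < S.+1) w k * x ^+ k) ^+ N.
Proof.
move=> w0 x0; rewrite -horner_poly -/(gf S.+1 w) -horner_exp.
have [lt|ge] := ltnP S (size (gf S.+1 w ^+ N)); last first.
  rewrite /powcoef nth_default// mul0r horner_exp exprn_ge0// horner_poly.
  by apply: sumr_ge0 => k _; rewrite mulr_ge0// exprn_ge0.
rewrite horner_coef (bigD1 (Ordinal lt))//= lerDl; apply: sumr_ge0 => k _.
have := lecoef_exp0 N (gf_ge0 S.+1 w0) k; rewrite coef0 => ?.
by rewrite mulr_ge0// exprn_ge0.
Qed.

Lemma powcoef_scale w N S (a x : R) :
  powcoef (fun k => a * w k * x ^+ k) N S = a ^+ N * x ^+ S * powcoef w N S.
Proof.
elim: N S => [|N IH] S.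
  rewrite !powcoef0 expr0 mul1r; case: S => [|S]; first by rewrite expr0 mulr1.
  by rewrite mulr0.
rewrite !powcoef_rec mulr_sumr; apply: eq_bigr => k _.
have kS : (k <= S)%N by rewrite -ltnS.
have -> : x ^+ S = x ^+ k * x ^+ (S - k) by rewrite -exprD subnKC.
by rewrite IH exprS; ring.
Qed.

Lemma powcoef_le w w' N S : (forall k, 0 <= w k <= w' k) ->
  powcoef w N S <= powcoef w' N S.
Proof.
move=> ww'; apply: lecoef_exp; first by apply: gf_ge0 => k; case/andP: (ww' k).
by apply: gf_le => k; case/andP: (ww' k).
Qed.

Lemma powcoef_diag_gt0 w N S : (forall k, 0 <= w k) -> (S <= N)%N ->
  0 < powcoef w N S ->
  0 < powcoef w S S /\ w 0%N ^+ (N - S) * powcoef w S S <= powcoef w N S.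
Proof.
move=> w0 /subnKC <-; elim: (N - S)%N => {N} [|d IH].
  by rewrite addn0 subnn mul1r.
rewrite addnS subSn ?leq_addr// exprS -mulrA => pos.
have pos' : 0 < powcoef w (S + d) S.
  have := powcoef_zero w0 (leq_addr d S); rewrite lt_neqAle powcoef_ge0// andbT.
  by apply: contraTneq => <-; rewrite mulr0 -ltNge.
have [? le] := IH pos'; split => //.
by apply: le_trans (powcoef_add_zeros _ _ w0); rewrite ler_wpM2l.
Qed.

Lemma powcoef_total_ge w n : (forall k, 0 <= w k) -> (0 < n)%N ->
  0 < powcoef w n n.-1 ->
  0 < powcoef w n.-1 n.-1 /\ w 0%N * powcoef w n.-1 n.-1 <= powcoef w n n.-1.
Proof.
move=> w0 n0 /(powcoef_diag_gt0 w0 (leq_pred n)) [? le]; split => //.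
by move: le; rewrite -{1}(prednK n0) subSnn expr1.
Qed.

(** Bernoulli's inequality. *)
Lemma expr_ge_bernoulli (u : R) k : 0 <= u -> 1 - k%:R * (1 - u) <= u ^+ k.
Proof.
move=> u0; elim: k => [|k IH]; first by rewrite mul0r subr0 expr0.
rewrite exprS; apply: le_trans (ler_wpM2l u0 IH); rewrite -natr1.
have := mulr_ge0 (ler0n R k) (sqr_ge0 (1 - u)).
by move: (k%:R : R) => a; lra.
Qed.

Lemma expR_le_quadratic (y : R) : `|y| <= 1 / 2 -> expR y <= 1 + y + 2 * y ^+ 2.
Proof.
move=> /ler_normlP[y1 y2].
have e0 := expR_gt0 y; have := expR_ge1Dx (- y); rewrite expRN => h.
have le1 : (1 - y) * expR y <= 1 by rewrite -ler_pdivlMr// div1r.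
have ? : 0 <= y ^+ 2 * (1 - 2 * y) by rewrite mulr_ge0 ?sqr_ge0//; lra.
have y0 : 0 < 1 - y by lra.
by rewrite -(ler_pM2l y0); apply: le_trans le1 _; lra.
Qed.

(** ** Positive radius of convergence *)

(** [F] is the value of the generating function at [rho]. *)
Record at_radius w (rho F : R) : Prop := AtRadius {
  radius_gt0 : 0 < rho;
  total_gt0 : 0 < F;
  partial_le : forall B, \sum_(k < B) w k * rho ^+ k <= F;
  partial_cvg : forall e, 0 < e -> exists B, F - e <= \sum_(k < B) w k * rho ^+ k;
  partial_dvg : forall t, rho < t -> forall A : R,
    exists B, A <= \sum_(k < B) w k * t ^+ k }.

(** If the mean at [rho] is at most 1, convexity puts the graph of the
    generating function above the line from 0 to its value at [rho]. *)
Lemma at_radius_growth w rho F kap : (forall k, 0 <= w k) -> at_radius w rho F ->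
  (forall B, \sum_(k < B) k%:R * (w k * rho ^+ k) <= F) -> kap < F / rho ->
  forall t : R, 0 < t -> exists B, kap * t <= \sum_(k < B) w k * t ^+ k.
Proof.
move=> w0 [rho0 F0 ple pcvg pdvg] mean kapF t t0.
have [rt|tr] := ltP rho t; first exact: pdvg.
have e0 : 0 < (F / rho - kap) * t by rewrite mulr_gt0// subr_gt0.
have [B hB] := pcvg _ e0; exists B.
pose u := t / rho.
have u0 : 0 <= u by rewrite divr_ge0// ltW.
have u1 : u <= 1 by rewrite ler_pdivrMr// mul1r.
apply: (@le_trans _ _ (\sum_(k < B) w k * rho ^+ k * (1 - k%:R * (1 - u)))); last first.
  apply: ler_sum => k _; have -> : t ^+ k = rho ^+ k * u ^+ k.
    by rewrite -exprMn mulrC divfK// gt_eqF.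
  by rewrite mulrA ler_wpM2l ?expr_ge_bernoulli// mulr_ge0// exprn_ge0// ltW.
have -> : \sum_(k < B) w k * rho ^+ k * (1 - k%:R * (1 - u)) =
    \sum_(k < B) w k * rho ^+ k - (1 - u) * \sum_(k < B) k%:R * (w k * rho ^+ k).
  by rewrite mulr_sumr -sumrB; apply: eq_bigr => k _; ring.
have := ler_wpM2l (_ : 0 <= 1 - u) (mean B); rewrite subr_ge0 => /(_ u1).
have -> : kap * t = F * u - (F / rho - kap) * t by rewrite /u; ring.
by move: hB; lra.
Qed.

(** A bounded function with negative mean has an exponential moment below 1. *)
Lemma exp_moment_lt1 w rho F (f : nat -> R) (C del : R) : (forall k, 0 <= w k) ->
  at_radius w rho F -> (forall k, `|f k| <= C) -> 0 < del ->
  (exists B0, forall B, (B0 <= B)%N ->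
    \sum_(k < B) w k * rho ^+ k * f k <= - del * F) ->
  exists s q : R, [/\ 0 < s, 0 <= q < 1 &
    forall B, \sum_(k < B) w k * expR (s * f k) * rho ^+ k <= q * F].
Proof.
move=> w0 [rho0 F0 ple _ _] fC del0 [B0 mean].
have C0 : 0 <= C by apply: le_trans (fC 0%N); exact: normr_ge0.
pose C1 := C + 1 + del; have C10 : 0 < C1 by rewrite /C1; lra.
pose s := del / (4 * C1 ^+ 2).
have s0 : 0 < s by rewrite divr_gt0// mulr_gt0// exprn_gt0.
have sE : s * (4 * C1 ^+ 2) = del.
  by rewrite divfK// gt_eqF// mulr_gt0// exprn_gt0.
have sC : s * C1 <= 1 / 4.
  have delC : del <= C1 by rewrite /C1; lra.
  by rewrite -(ler_pM2r C10) -mulrA -expr2; lra.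
exists s, (1 - s * del / 2); split => //.
  have sd : s * del <= 1 / 4.
    by apply: le_trans sC; rewrite ler_wpM2l ?ltW//; rewrite /C1; lra.
  by have := mulr_gt0 s0 del0; lra.
move=> B; pose B1 := maxn B B0.
apply: (@le_trans _ _ (\sum_(k < B1) w k * expR (s * f k) * rho ^+ k)).
  rewrite -!(big_mkord xpredT (fun k => w k * expR (s * f k) * rho ^+ k)).
  rewrite (@big_cat_nat _ _ _ B 0 B1)//= ?leq_maxl// lerDl sumr_ge0// => k _.
  by rewrite !mulr_ge0 ?expR_ge0// exprn_ge0// ltW.
apply: (@le_trans _ _ (\sum_(k < B1) (w k * rho ^+ k +
    s * (w k * rho ^+ k * f k) + 2 * s ^+ 2 * C1 ^+ 2 * (w k * rho ^+ k)))).
  apply: ler_sum => k _; rewrite mulrAC.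
  have -> : w k * rho ^+ k + s * (w k * rho ^+ k * f k) +
      2 * s ^+ 2 * C1 ^+ 2 * (w k * rho ^+ k) =
      w k * rho ^+ k * (1 + s * f k + 2 * s ^+ 2 * C1 ^+ 2) by ring.
  apply: ler_wpM2l; first by rewrite mulr_ge0// exprn_ge0// ltW.
  have [f1 f2] := ler_normlP _ _ (fC k).
  have fk : `|s * f k| <= s * C1.
    by rewrite normrM gtr0_norm// ler_wpM2l ?(ltW s0)//; have := fC k; rewrite /C1; lra.
  apply: le_trans (expR_le_quadratic _) _; first by lra.
  rewrite lerD2l -mulrA ler_pM2l// -exprMn -[(s * f k) ^+ 2]real_normK ?num_real//.
  by apply: lerXn2r; rewrite ?nnegrE// mulr_ge0// ltW.
rewrite !big_split/= -!mulr_sumr.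
have m1 := ple B1; have m2 := mean B1 (leq_maxr _ _).
have := ler_wpM2l (ltW s0) m2.
have c2 : 2 * s ^+ 2 * C1 ^+ 2 = s * del / 2 by rewrite -sE; field.
have := ler_wpM2l (_ : 0 <= s * del / 2) m1; rewrite c2.
have sd := mulr_gt0 s0 del0; have -> : 0 <= s * del / 2 by lra.
by move=> /(_ isT); lra.
Qed.

(** Chernoff's bound at [rho] gives a rate below [F / rho], the growth rate of
    the total weight. *)
Lemma flat_rare_positive_radius w rho F K (f : nat -> R) (C A del : R) :
  (forall k, 0 <= w k) -> 0 < w 0%N -> at_radius w rho F ->
  (forall B, \sum_(k < B) k%:R * (w k * rho ^+ k) <= F) ->
  (forall k, `|f k| <= C) -> 0 < del ->
  (exists B0, forall B, (B0 <= B)%N ->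
    \sum_(k < B) w k * rho ^+ k * f k <= - del * F) ->
  (forall n (c : 'I_n -> nat), (0 < n)%N -> (\sum_i c i = n.-1)%N ->
    second_moment c < K * n%:R -> - A <= \sum_i f (c i)) ->
  flat_rare w K.
Proof.
move=> w0 w0_gt0 rad mean1 fC del0 mean flat.
have [s [q [s0 /andP[q0 q1] mom]]] := exp_moment_lt1 w0 rad fC del0 mean.
have [rho0 F0 _ _ _] := rad.
(* The rates of the rare weight, of the total weight, and of the hypothesis on
   the growth: [q < q' < q1' < 1], in units of [F / rho]. *)
pose q1' := (q + 2) / 3; pose q' := (q + 1) / 2.
have [qq' q'q1' q1'1] : [/\ q < q', q' < q1' & q1' < 1] by rewrite /q' /q1'; split; lra.
clearbody q' q1'; have q'0 : 0 < q' by lra.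
have Fr : 0 < F / rho by rewrite divr_gt0.
have kk : 0 < q' * (F / rho) < q1' * (F / rho) by rewrite mulr_gt0//= ltr_pM2r.
have growth : forall t : R, 0 < t ->
    exists B, q1' * (F / rho) * t <= \sum_(k < B) w k * t ^+ k.
  by apply: (at_radius_growth w0 rad mean1); rewrite gtr_pMl.
have [c c0 hc] := powcoef_diag_growth w0 w0_gt0 kk growth.
exists (expR (s * A) * (F * q') / (w 0%N * c)), (q / q'); split.
- by rewrite divr_ge0 ?mulr_ge0 ?expR_ge0 ?(ltW F0) ?(ltW q'0) ?(ltW c0).
- by rewrite divr_ge0//= ?(ltW q'0)// ltr_pdivrMr// mul1r.
move=> n n0 Lpos; have [apos le] := powcoef_total_ge w0 n0 Lpos.
have low := le_trans (ler_wpM2l (w0 0%N) (hc _ apos)) le.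
have up : flat_weight w K n <= expR (s * A) * ((q * F) ^+ n / rho ^+ n.-1).
  apply: le_trans (@flat_weight_le_tilted w (fun k => expR (s * f k)) K n
    (expR (s * A)) n0 w0 _ _ _) _.
  - by move=> k; exact: expR_ge0.
  - exact: expR_ge0.
  - move=> d sumd X; rewrite -expR_sum -expRD -expR0 ler_expR -mulr_sumr -mulrDr.
    by rewrite mulr_ge0 ?(ltW s0)//; have := flat n d n0 sumd X; lra.
  rewrite ler_wpM2l ?expR_ge0// ler_pdivlMr ?exprn_gt0//.
  apply: le_trans (powcoef_le_horner _ _ _ (ltW rho0)) _.
    by move=> k; rewrite mulr_ge0 ?expR_ge0.
  apply: lerXn2r; rewrite ?nnegrE ?mom ?mulr_ge0 ?(ltW F0)//.
  by apply: sumr_ge0 => k _; rewrite !mulr_ge0 ?expR_ge0// exprn_ge0// ltW.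
apply: le_trans up _.
have -> : expR (s * A) * ((q * F) ^+ n / rho ^+ n.-1) =
    expR (s * A) * (F * q') / (w 0%N * c) * (q / q') ^+ n *
    (w 0%N * (c * (q' * (F / rho)) ^+ n.-1)).
  rewrite -(prednK n0) /= !exprMn !exprVn !exprS.
  by field; rewrite !expf_neq0 ?gt_eqF.
apply: ler_wpM2l => //; rewrite mulr_ge0 ?exprn_ge0 ?divr_ge0 ?mulr_ge0 ?expR_ge0//.
all: exact: ltW.
Qed.

Lemma nat_above (x : R) : exists2 M, (0 < M)%N & x <= M%:R.
Proof.
exists (Num.bound `|x|).+1 => //; apply: le_trans (ler_norm x) _.
by apply: ltW; apply: lt_le_trans (archi_boundP (normr_ge0 x)) _; rewrite ler_nat.
Qed.

Lemma trunc_le M k : (trunc M k <= M)%N.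
Proof. by rewrite /trunc; case: ifP. Qed.

(** Mean below 1: the small entries cannot make up the sum [n - 1]. *)
Lemma flat_rare_subcritical w rho F nu K : (forall k, 0 <= w k) -> 0 < w 0%N ->
  at_radius w rho F -> nu < 1 ->
  (forall B, \sum_(k < B) k%:R * (w k * rho ^+ k) <= nu * F) -> flat_rare w K.
Proof.
move=> w0 w0_gt0 rad nu1 mean; have [rho0 F0 ple pcvg _] := rad.
have [M M0 hM] := nat_above (2 * K / ((1 - nu) / 4)).
have MR : 0 < M%:R :> R by rewrite ltr0n.
have nu0 : 0 <= nu by have := mean 0; rewrite big_ord0 pmulr_lge0.
pose e := 2 * K / M%:R.
have e_le : e <= (1 - nu) / 4.
  have d0 : 0 < (1 - nu) / 4 by lra.
  by rewrite /e ler_pdivrMr// [leRHS]mulrC -ler_pdivrMr.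
pose f k : R := (trunc M k)%:R - 1 + e.
have eF : 0 < (1 - nu) / 4 * F by rewrite mulr_gt0//; lra.
apply: (@flat_rare_positive_radius w rho F K f (M%:R + 1 + `|e|) 1 ((1 - nu) / 4)) => //.
- move=> B; apply: le_trans (mean B) _; rewrite ler_piMl//; lra.
- move=> k; rewrite /f (le_trans (ler_normD _ _))// lerD2r.
  rewrite (le_trans (ler_normB _ _))// normr1 lerD2r ger0_norm// ler_nat.
  exact: trunc_le.
- by lra.
- have [B0 hB0] := pcvg _ eF; exists B0 => B B0B.
  apply: (@le_trans _ _ (\sum_(k < B) k%:R * (w k * rho ^+ k) -
      (1 - e) * \sum_(k < B) w k * rho ^+ k)).
    rewrite mulr_sumr -sumrB; apply: ler_sum => k _.
    have wk : 0 <= w k * rho ^+ k by rewrite mulr_ge0// exprn_ge0// ltW.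
    have : (trunc M k)%:R <= k%:R :> R by rewrite ler_nat /trunc; case: ifP.
    by move=> /(ler_wpM2l wk); rewrite /f; lra.
  have : \sum_(k < B0) w k * rho ^+ k <= \sum_(k < B) w k * rho ^+ k.
    rewrite -!(big_mkord xpredT (fun k => w k * rho ^+ k)).
    rewrite (@big_cat_nat _ _ _ B0 0 B)//= lerDl sumr_ge0// => k _.
    by rewrite mulr_ge0// exprn_ge0// ltW.
  move: (mean B) (ple B) hB0; set x := \sum_(k < B) w k * _.
  move: (\sum_(k < B) _) (\sum_(k < B0) _) => y z yF xF zF xz.
  have e1 : 0 <= 1 - (1 - nu) / 4 by lra.
  have : (1 - (1 - nu) / 4) * (F - (1 - nu) / 4 * F) <= (1 - e) * x.
    by apply: ler_pM => //; nra.
  nra.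
- move=> n c n0 sumc X; have := flat_trunc_mass M0 n0 sumc X.
  rewrite /f big_split/= sumrB !sumr_const card_ord natr_sum -/e -[e *+ n]mulr_natr.
  by lra.
Qed.

(** Infinite variance: so are the truncated second moments, eventually above
    any bound. *)
Lemma flat_rare_infinite_variance w rho F K : (forall k, 0 <= w k) -> 0 < w 0%N ->
  at_radius w rho F ->
  (forall B, \sum_(k < B) k%:R * (w k * rho ^+ k) <= F) ->
  (forall A : R, exists B, A <= \sum_(k < B) (k%:R - 1) ^+ 2 * (w k * rho ^+ k)) ->
  flat_rare w K.
Proof.
move=> w0 w0_gt0 rad mean var; have [rho0 F0 ple _ _] := rad.
have [M hM] := var ((`|K| + 1) * F).
pose sq k : R := if (k < M)%N then (k%:R - 1) ^+ 2 else 0.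
have sq0 k : 0 <= sq k by rewrite /sq; case: ifP => // _; exact: sqr_ge0.
apply: (@flat_rare_positive_radius w rho F K (fun k => K - sq k)
  (`|K| + (M%:R + 1) ^+ 2) 0 1) => //.
- move=> k; rewrite (le_trans (ler_normB _ _))// lerD2l ger0_norm// /sq.
  case: ltnP => kM; last exact: sqr_ge0.
  have : k%:R <= M%:R :> R by rewrite ler_nat ltnW.
  by have := ler0n R k; move: (k%:R : R) (M%:R : R) => a b; nra.
- exists M => B MB.
  have -> : \sum_(k < B) w k * rho ^+ k * (K - sq k) =
      K * \sum_(k < B) w k * rho ^+ k - \sum_(k < B) sq k * (w k * rho ^+ k).
    by rewrite mulr_sumr -sumrB; apply: eq_bigr => k _; ring.
  have : (`|K| + 1) * F <= \sum_(k < B) sq k * (w k * rho ^+ k).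
    apply: le_trans hM _.
    rewrite -(big_mkord xpredT (fun k => sq k * (w k * rho ^+ k))).
    rewrite (@big_cat_nat _ _ _ M 0 B)//= big_mkord ler_wpDr//.
      by apply: sumr_ge0 => k _; rewrite !mulr_ge0// exprn_ge0// ltW.
    by apply: ler_sum => k _; rewrite /sq ltn_ord.
  have S0 : 0 <= \sum_(k < B) w k * rho ^+ k.
    by apply: sumr_ge0 => k _; rewrite mulr_ge0// exprn_ge0// ltW.
  have : K * (\sum_(k < B) w k * rho ^+ k) <= `|K| * F.
    apply: (@le_trans _ _ (`|K| * \sum_(k < B) w k * rho ^+ k)).
      by rewrite ler_wpM2r// ler_norm.
    by rewrite ler_wpM2l.
  by lra.
- move=> n c n0 sumc X; rewrite sumrB sumr_const card_ord oppr0 subr_ge0.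
  rewrite -mulr_natr; apply: le_trans (ltW X); apply: ler_sum => i _.
  by rewrite /sq; case: ifP => // _; exact: sqr_ge0.
Qed.

(** ** Zero radius of convergence *)

Lemma coef_exp_lt (p : {poly R}) j i : p`_0 = 0 -> (i < j)%N -> (p ^+ j)`_i = 0.
Proof.
move=> p0; elim: j i => // j IH i ij; rewrite exprS coefM big1// => k _.
case: (posnP k) => [->|k0]; first by rewrite p0 mul0r.
by have ki := ltn_ord k; rewrite IH ?mulr0//; lia.
Qed.

Lemma powcoef_le_mass w N S M (W : R) : (forall k, 0 <= w k) ->
  (forall k, (M < k)%N -> w k = 0) -> \sum_(k < M.+1) w k <= W ->
  powcoef w N S <= W ^+ N.
Proof.
move=> w0 wM sW; have := powcoef_le_horner N S w0 ler01.
rewrite expr1n mulr1 => /le_trans; apply; apply: lerXn2r; rewrite ?nnegrE.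
- by apply: sumr_ge0 => k _; rewrite expr1n mulr1.
- by apply: le_trans sW; apply: sumr_ge0.
rewrite (eq_bigr (fun k : 'I__ => w k)) => [|k _]; last by rewrite expr1n mulr1.
apply: le_trans sW.
rewrite -!(big_mkord xpredT w); have [SM|MS] := leqP S M.
  by rewrite (@big_cat_nat _ _ _ S.+1 0 M.+1)//= lerDl sumr_ge0.
rewrite (@big_cat_nat _ _ _ M.+1 0 S.+1)//= 1?ltnW//.
rewrite [X in _ + X]big1_seq ?addr0// => k /andP[_].
by rewrite mem_index_iota => /andP[? _]; exact: wM.
Qed.

(** With radius 0 the diagonal coefficients beat every exponential, whereas the
    entries up to [M] alone produce only an exponential, even after the tilt
    [a ^ k].  The large entries are kept as they are.  A sequence splits into
    its small and its large entries in at most [2 ^ n] ways, and the small ones,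
    of which there are more than their sum, can be replaced by arbitrary ones. *)
Lemma powcoef_tilt_small w M (a : R) : (forall k, 0 <= w k) -> 0 < w 0%N -> 0 < a ->
  (forall t, 0 < t -> forall A : R, exists B, A <= \sum_(k < B) w k * t ^+ k) ->
  exists2 D : R, 0 < D & forall n, (0 < n)%N ->
    powcoef (fun k => w k * a ^+ trunc M k) n n.-1 <=
    D * (2 * ((1 + \sum_(k < M.+1) w k) * (1 + (w 0%N)^-1))) ^+ n *
    powcoef w n n.-1.
Proof.
move=> w0 w0_gt0 a0 dvg.
have aa : 0 < a < a + 1 by rewrite a0 ltrDl ltr01.
have growth : forall t : R, 0 < t ->
    exists B, (a + 1) * t <= \sum_(k < B) w k * t ^+ k.
  by move=> t t0; exact: dvg.
have [c c0 hc] := powcoef_diag_growth w0 w0_gt0 aa growth.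
pose W := 1 + \sum_(k < M.+1) w k; pose V := 1 + (w 0%N)^-1.
have W1 : 1 <= W by rewrite lerDl sumr_ge0.
have V1 : 1 <= V by rewrite lerDl invr_ge0.
have V0 : 1 <= V * w 0%N by rewrite /V mulrDl mul1r mulVf ?gt_eqF// lerDr.
exists c^-1; first by rewrite invr_gt0.
move=> n n0; pose sm k := if (k <= M)%N then w k else 0.
pose lg k := if (k <= M)%N then 0 else w k.
have sm0 k : 0 <= sm k by rewrite /sm; case: ifP.
have lg0 k : 0 <= lg k by rewrite /lg; case: ifP.
pose smA k := 1 * sm k * a ^+ k.
have smA0 k : 0 <= smA k by rewrite /smA mul1r mulr_ge0// exprn_ge0// ltW.
have tiltE : gf n (fun k => w k * a ^+ trunc M k) = gf n smA + gf n lg.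
  apply/polyP => k; rewrite coefD !coef_poly; case: ifP => _; last by rewrite addr0.
  rewrite /smA /sm /lg /trunc; case: ifP => _; first by rewrite mul1r addr0.
  by rewrite mulr0 mul0r add0r expr0 mulr1.
have small l m : (l <= n)%N -> (m <= l)%N ->
    powcoef smA l m <= c^-1 * (W * V) ^+ n * powcoef w l m.
  move=> ln ml; rewrite powcoef_scale expr1n mul1r.
  have p0 : 0 <= powcoef w l m by exact: powcoef_ge0.
  have WV1 : 1 <= W * V by rewrite (le_trans W1)// ler_peMr// (le_trans ler01).
  have [->|ne] := eqVneq (powcoef sm l m) 0.
    by rewrite mulr0 !mulr_ge0 ?invr_ge0 ?(ltW c0)// exprn_ge0// (le_trans ler01).
  have smw : powcoef sm l m <= powcoef w l m.
    by apply: powcoef_le => k; rewrite sm0 /sm; case: ifP => _ /=.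
  have pos : 0 < powcoef w l m.
    by apply: lt_le_trans smw; rewrite lt0r ne powcoef_ge0.
  have [dpos dle] := powcoef_diag_gt0 w0 ml pos.
  have low : c * a ^+ m <= V ^+ (l - m) * powcoef w l m.
    apply: (@le_trans _ _ (powcoef w m m)); first exact: hc.
    apply: le_trans (ler_wpM2l (exprn_ge0 _ (le_trans ler01 V1)) dle).
    by rewrite mulrA -exprMn ler_peMl ?exprn_ege1// ltW.
  have massW : powcoef sm l m <= W ^+ l.
    apply: (@powcoef_le_mass _ _ _ M) => //.
      by move=> k Mk; rewrite /sm leqNgt Mk.
    have -> : \sum_(k < M.+1) sm k = \sum_(k < M.+1) w k.
      by apply: eq_bigr => k _; rewrite /sm -ltnS ltn_ord.
    by rewrite /W lerDr.
  rewrite -[leRHS]mulrA ler_pdivlMl// mulrA exprMn; apply: le_trans (ler_pM _ _ low massW) _.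
  - by rewrite mulr_ge0 ?exprn_ge0// ltW.
  - exact: powcoef_ge0.
  have Wn : W ^+ l <= W ^+ n by rewrite ler_weXn2l.
  have Vn : V ^+ (l - m) <= V ^+ n.
    by rewrite ler_weXn2l// (leq_trans (leq_subr _ _)).
  rewrite mulrAC; apply: ler_wpM2r => //.
  by rewrite mulrC; apply: ler_pM => //; rewrite exprn_ge0// (le_trans ler01).
rewrite -(@powcoefE _ n) ?prednK// tiltE exprDn coef_sum.
apply: (@le_trans _ _ (c^-1 * (W * V) ^+ n * ((gf n w + gf n lg) ^+ n)`_n.-1)).
  rewrite exprDn coef_sum mulr_sumr; apply: ler_sum => j _.
  rewrite !coefMn mulrnAr; apply: ler_wMn2r.
  rewrite !coefM mulr_sumr; apply: ler_sum => m _.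
  have mn : (m < n)%N by rewrite -[X in (_ < X)%N](prednK n0).
  have jn : (j <= n)%N by rewrite -ltnS.
  have [lt|ge] := ltnP (n.-1 - m) j.
    have -> : (gf n lg ^+ j)`_(n.-1 - m) = 0.
      by apply: coef_exp_lt => //; rewrite coef_poly /lg leq0n if_same.
    by rewrite !mulr0.
  rewrite mulrA; apply: ler_wpM2r.
    by have := lecoef_exp0 j (gf_ge0 n lg0) (n.-1 - m)%N; rewrite coef0.
  by rewrite !powcoefE// small ?leq_subr//; lia.
have double : ((gf n w + gf n lg) ^+ n)`_n.-1 <= 2 ^+ n * powcoef w n n.-1.
  have := powcoef_scale w n n.-1 2 1; rewrite expr1n mulr1 => <-.
  rewrite -(@powcoefE _ n) ?prednK//; apply: lecoef_exp => k.
    by rewrite coefD coef0 !coef_poly; case: ifP => _; rewrite ?addr0// addr_ge0.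
  rewrite coefD !coef_poly; case: ifP => _; rewrite ?addr0// expr1n mulr1.
  by rewrite mulrDl mul1r lerD2l /lg; case: ifP.
rewrite -/W -/V [(2 * _) ^+ n]exprMn [2 ^+ n * _]mulrC mulrA -[leRHS]mulrA.
have WV0 : 0 <= W * V by apply: mulr_ge0; exact: le_trans ler01 _.
by apply: ler_wpM2l double; rewrite mulr_ge0 ?invr_ge0 ?(ltW c0)// exprn_ge0.
Qed.

(** At least about half of the mass of a flat sequence lies in the small entries. *)
Lemma flat_rare_zero_radius w K : (forall k, 0 <= w k) -> 0 < w 0%N ->
  (forall t, 0 < t -> forall A : R, exists B, A <= \sum_(k < B) w k * t ^+ k) ->
  flat_rare w K.
Proof.
move=> w0 w0_gt0 dvg; have [M M0 hM] := nat_above (4 * K).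
have MR : 0 < M%:R :> R by rewrite ltr0n.
pose E := (1 + \sum_(k < M.+1) w k) * (1 + (w 0%N)^-1).
have E1 : 1 <= E.
  rewrite -[1]mulr1 /E; apply: ler_pM => //.
    by rewrite lerDl sumr_ge0.
  by rewrite lerDl invr_ge0.
pose b := 4 * E; have b1 : 1 <= b by rewrite /b; lra.
have b0 : 0 < b by lra.
have [D D0 hD] := powcoef_tilt_small M w0 w0_gt0 (exprn_gt0 2 b0) dvg.
(* The tilt [b ^ 2] per unit of small mass, which is at least [n / 2 - 1], gains
   [b ^ (n - 2)] against the loss [(2 E) ^ n]. *)
exists (b ^+ 2 * D), (1 / 2); split.
- by rewrite mulr_ge0 ?exprn_ge0// ltW.
- by apply/andP; split; lra.
move=> n n0 _.
have C0 : 0 <= b ^+ 2 / b ^+ n by rewrite divr_ge0 ?exprn_ge0// ltW.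
apply: le_trans (@flat_weight_le_tilted w (fun k => (b ^+ 2) ^+ trunc M k) K n
  (b ^+ 2 / b ^+ n) n0 w0 _ C0 _) _.
- by move=> k; rewrite !exprn_ge0// ltW.
- move=> c sumc X; have mass := flat_trunc_mass M0 n0 sumc X.
  rewrite prodrXr -exprM mulrAC ler_pdivlMr ?exprn_gt0// mul1r -exprD ler_weXn2l//.
  rewrite -(ler_nat R) natrD natrM.
  have : 2 * K / M%:R * n%:R <= 1 / 2 * n%:R.
    by rewrite ler_wpM2r// ler_pdivrMr//; lra.
  by move: mass; lra.
apply: le_trans (ler_wpM2l C0 (hD n n0)) _; rewrite -/E.
rewrite (_ : b ^+ 2 / b ^+ n * _ = b ^+ 2 * D * (1 / 2) ^+ n * powcoef w n n.-1)//.
have -> : 1 / 2 = 2 * E / b :> R by rewrite /b; field; rewrite gt_eqF//; lra.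
by rewrite expr_div_n; ring.
Qed.

End RareSequences.

(** * The criteria on [nu] and [sigma2] *)

Section NonnegSeries.
Context {R : realType}.
Implicit Types u : nat -> R.
Local Open Scope ereal_scope.

Lemma nnser_ge u B : (forall k, 0 <= u k)%R ->
  (\sum_(k < B) u k)%R%:E <= \sum_(0 <= k <oo) (u k)%:E.
Proof.
move=> u0; apply: le_trans (nneseries_lim_ge B _); last first.
  by move=> k _ _; rewrite lee_fin.
by rewrite big_mkord sumEFin.
Qed.

Lemma nnser_ge0 u : (forall k, 0 <= u k)%R -> 0 <= \sum_(0 <= k <oo) (u k)%:E.
Proof. by move=> u0; apply: le_trans (nnser_ge 0 u0); rewrite big_ord0. Qed.

Lemma nnser_le u x : (forall k, 0 <= u k)%R ->
  (forall B, (\sum_(k < B) u k)%R%:E <= x) -> \sum_(0 <= k <oo) (u k)%:E <= x.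
Proof.
move=> u0 ux; apply: lime_le.
  by apply: is_cvg_nneseries => k _ _; rewrite lee_fin.
by near=> B; rewrite big_mkord sumEFin.
Unshelve. all: by end_near. Qed.

Lemma nnser_gt u x : (forall k, 0 <= u k)%R ->
  x < \sum_(0 <= k <oo) (u k)%:E -> exists B, x < (\sum_(k < B) u k)%R%:E.
Proof.
move=> u0; rewrite ltNge => /negP H; apply: contrapT => /forallNP nB; apply: H.
by apply: nnser_le => // B; rewrite leNgt; exact/negP.
Qed.

Lemma nnser_mono u v : (forall k, 0 <= u k <= v k)%R ->
  \sum_(0 <= k <oo) (u k)%:E <= \sum_(0 <= k <oo) (v k)%:E.
Proof.
move=> uv; apply: nnser_le => [k|B]; first by case/andP: (uv k).
have v0 k : (0 <= v k)%R by case/andP: (uv k) => /le_trans; apply.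
apply: le_trans (nnser_ge B v0); rewrite lee_fin; apply: ler_sum => k _.
by case/andP: (uv k).
Qed.

Lemma nnser_prod_le u v (U V C : R) : (forall k, 0 <= u k)%R ->
  (forall k, 0 <= v k)%R -> \sum_(0 <= k <oo) (u k)%:E = U%:E ->
  \sum_(0 <= k <oo) (v k)%:E = V%:E ->
  (forall B B', (\sum_(k < B) u k) * (\sum_(k < B') v k) <= C)%R -> (U * V <= C)%R.
Proof.
move=> u0 v0 uU vV uvC.
have C0 : (0 <= C)%R by apply: le_trans (uvC 0 0)%N; rewrite big_ord0 mul0r.
have U0 : (0 <= U)%R by rewrite -lee_fin -uU nnser_ge0.
have partial B : (U * \sum_(k < B) v k <= C)%R.
  have : (0 <= \sum_(k < B) v k)%R by exact: sumr_ge0.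
  rewrite le_eqVlt => /predU1P[<-|pos]; first by rewrite mulr0.
  rewrite -ler_pdivlMr// -lee_fin -uU; apply: nnser_le => // B'.
  by rewrite lee_fin ler_pdivlMr.
move: U0; rewrite le_eqVlt => /predU1P[<-|pos]; first by rewrite mul0r.
rewrite mulrC -ler_pdivlMr// -lee_fin -vV; apply: nnser_le => // B.
by rewrite lee_fin ler_pdivlMr// mulrC.
Qed.

End NonnegSeries.

Section MonotoneLimit.
Context {R : realType}.
Local Open Scope ereal_scope.

Lemma from_below_proper (x : \bar R) : ProperFilter (from_below x).
Proof.
case: x => [r| |] /=; [exact: at_left_proper_filter|exact: proper_pinfty_nbhs|].
exact: proper_ninfty_nbhs.
Qed.

Lemma from_below_near (x : \bar R) (s : R) : s%:E < x ->
  \forall t \near from_below x, (s < t)%R /\ t%:E < x.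
Proof.
case: x => [r| |] //=; rewrite ?lte_fin.
  move=> sr; near=> t; split; rewrite ?lte_fin; near: t.
    exact: nbhs_left_gt.
  exact: nbhs_left_lt.
by move=> _; near=> t; split; rewrite ?ltry//; near: t; exact: (nbhs_pinfty_gt (num_real s)).
Unshelve. all: by end_near. Qed.

(** A monotone function has a limit from below, possibly infinite, and this
    limit bounds its values. *)
Lemma le_lim_from_below (x : \bar R) (f : R -> \bar R) (s : R) : (0 <= s)%R ->
  s%:E < x -> (forall t, (0 < t)%R -> t%:E < x -> 0 <= f t) ->
  (forall t t', (0 < t <= t')%R -> t'%:E < x -> f t <= f t') ->
  forall t, (s < t)%R -> t%:E < x -> f t <= lim (f t @[t --> from_below x]).
Proof.
move=> s0 sx f0 fmono t st tx; set G := from_below x.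
have PG : ProperFilter G by exact: from_below_proper.
have t0 : (0 < t)%R by exact: le_lt_trans st.
pose l := ereal_sup [set f r | r in [set r | (0 < r)%R /\ r%:E < x]].
have fl r : (0 < r)%R -> r%:E < x -> f r <= l.
  by move=> ? ?; apply: ereal_sup_ubound; exists r.
have nearf r : (0 < r)%R -> r%:E < x -> \forall y \near G, f r <= f y /\ f y <= l.
  move=> r0 rx; near=> y.
  have [ry yx] : (r < y)%R /\ y%:E < x by near: y; exact: from_below_near.
  split; first by apply: fmono => //; rewrite r0 /= ltW.
  by apply: fl => //; exact: lt_trans ry.
have cv : f y @[y --> G] --> l.
  have l0 : 0 <= l by apply: le_trans (fl _ t0 tx); exact: f0.
  have approx (A : R) : A%:E < l -> \forall y \near G, A%:E <= f y /\ f y <= l.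
    move=> /ereal_sup_gt[_ [r [r0 rx] <-] Ar]; near=> y.
    have [? ?] : f r <= f y /\ f y <= l by near: y; exact: nearf.
    by split => //; exact: le_trans (ltW Ar) _.
  case: l l0 fl nearf approx => [l| |] //= l0 fl nearf approx; last first.
    by apply/cvgeyPge => A; have := approx A (ltry A); apply: filterS => y [].
  have fin : \forall y \near G, f y \is a fin_num.
    have := nearf _ t0 tx; apply: filterS => y [ty yl].
    rewrite ge0_fin_numE; first exact: le_lt_trans yl (ltry _).
    exact: le_trans (f0 _ t0 tx) ty.
  apply: cvg_EFin => //; apply/cvgrPdist_le => e e0.
  have le : (l - e)%:E < l%:E by rewrite lte_fin gtrBl.
  have := approx _ le; apply: filterS2 fin => y fy [].
  rewrite -(fineK fy) !lee_fin /= => y1 y2.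
  by rewrite ger0_norm ?subr_ge0//; lra.
apply: lime_ge; first by apply/cvg_ex; exists l.
by have := nearf _ t0 tx; apply: filterS => y [].
Unshelve. all: by end_near. Qed.

End MonotoneLimit.

(** One-sided Lipschitz bounds control [derive1] even where the difference
    quotients diverge, since it is then 0 by default. *)
Lemma derive1_le (R : realType) (g : R -> R) (a b t C : R) : a < t < b -> 0 <= C ->
  (forall x y, a < x <= y -> y < b -> g y - g x <= C * (y - x)) -> derive1 g t <= C.
Proof.
move=> /andP[at_ tb] C0 gC; rewrite /derive1.
have [cv|ncv] := pselect (cvg (h^-1 *: (g (h + t) - g t) @[h --> 0^'])); last first.
  by rewrite (dvgP ncv).
apply: limr_le => //; near=> h.
have hd : `|h| < Num.min (t - a) (b - t).
  by near: h; apply: dnbhs0_lt; rewrite lt_min !subr_gt0 at_.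
have h0 : h != 0 by near: h; exact: nbhs_dnbhs_neq.
move: hd; rewrite lt_min !ltr_norml => /andP[/andP[h1 h2] /andP[h3 h4]].
rewrite [_ *: _]mulrC; move: h0; rewrite neq_lt => /orP[hn|hp].
  rewrite ler_ndivrMr//; have := gC (h + t) t.
  have -> : a < h + t <= t by apply/andP; split; lra.
  by move=> /(_ isT tb); lra.
rewrite ler_pdivrMr//; have := gC t (h + t).
have -> : a < t <= h + t by apply/andP; split; lra.
have -> : h + t < b by lra.
by move=> /(_ isT)/(_ isT); lra.
Unshelve. all: by end_near. Qed.

Section Criteria.
Context {R : realType}.
Variable w : nat -> R.
Hypothesis w_ge0 : forall k, 0 <= w k.
Hypothesis w0_gt0 : 0 < w 0%N.
Hypothesis w_gt0 : exists k, (2 <= k)%N /\ 0 < w k.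
Implicit Types (s t : R) (B : nat).

Let Num t : \bar R := (\sum_(0 <= k <oo) (k%:R * w k * t ^+ k)%:E)%E.

Let term0 t k : 0 <= t -> 0 <= w k * t ^+ k.
Proof. by move=> t0; rewrite mulr_ge0// exprn_ge0. Qed.

Let nterm0 t k : 0 <= t -> 0 <= k%:R * w k * t ^+ k.
Proof. by move=> t0; rewrite !mulr_ge0// exprn_ge0. Qed.

Lemma Phi_mono s t : 0 <= s <= t -> (Phi w s <= Phi w t)%E.
Proof.
move=> /andP[s0 st]; apply: nnser_mono => k; rewrite term0//=.
by rewrite ler_wpM2l// lerXn2r// nnegrE (le_trans s0).
Qed.

Lemma rho_ge0 : (0 <= rho w)%E.
Proof.
apply: ereal_sup_ubound; exists 0 => //; split => //.
apply: le_lt_trans (ltry (w 0%N)); apply: nnser_le => [k|B]; first exact: term0.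
rewrite lee_fin; case: B => [|B]; first by rewrite big_ord0.
rewrite big_ord_recl/= expr0 mulr1 big1 ?addr0// => i _.
by rewrite expr0n/= mulr0.
Qed.

Lemma Phi_lty t : 0 <= t -> (t%:E < rho w)%E -> (Phi w t < +oo)%E.
Proof.
move=> t0 /ereal_sup_gt[_ [s [s0 sP] <-]]; rewrite lte_fin => ts.
by apply: le_lt_trans sP; apply: Phi_mono; rewrite t0 ltW.
Qed.

Lemma Phi_ey t : 0 <= t -> (rho w < t%:E)%E -> Phi w t = +oo%E.
Proof.
move=> t0 rt; apply/eqP; rewrite -leye_eq leNgt; apply/negP => tP.
by move: rt; rewrite ltNge => /negP; apply; apply: ereal_sup_ubound; exists t.
Qed.

Lemma Phi_gew0 t : 0 <= t -> ((w 0%N)%:E <= Phi w t)%E.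
Proof.
move=> t0; apply: le_trans (nnser_ge 1 (fun k => term0 k t0)).
by rewrite big_ord1 expr0 mulr1.
Qed.

(** By Bernoulli's inequality, [t ^ k - s ^ k <= k t ^ k (1 - s / t)]. *)
Lemma sum_pow_le (v : nat -> R) s t r B : (forall k, 0 <= v k) ->
  0 < s <= t -> t <= r ->
  \sum_(k < B) v k * t ^+ k <= \sum_(k < B) v k * s ^+ k +
    (1 - s / t) * \sum_(k < B) k%:R * v k * r ^+ k.
Proof.
move=> v0 /andP[s0 st] tr; have t0 := lt_le_trans s0 st.
rewrite mulr_sumr -big_split; apply: ler_sum => k _ /=.
have u0 : 0 <= s / t by rewrite divr_ge0// ltW.
have u1 : 0 <= 1 - s / t by rewrite subr_ge0 ler_pdivrMr// mul1r.
have tk : t ^+ k <= r ^+ k by apply: lerXn2r; rewrite ?nnegrE ?(le_trans (ltW t0)).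
have kt : 0 <= t ^+ k by rewrite exprn_ge0// ltW.
have -> : s ^+ k = t ^+ k * (s / t) ^+ k by rewrite -exprMn mulrC divfK// gt_eqF.
have := expr_ge_bernoulli k u0; set y := _ ^+ k; set x := s / t in u0 u1 y *.
move=> by_; have h1 : v k * t ^+ k * (1 - k%:R * (1 - x)) <= v k * t ^+ k * y.
  by rewrite ler_wpM2l// mulr_ge0.
have h2 : (1 - x) * (k%:R * v k * t ^+ k) <= (1 - x) * (k%:R * v k * r ^+ k).
  by rewrite ler_wpM2l// ler_wpM2l// mulr_ge0.
by move: h1 h2; lra.
Qed.

(** For [t < s], Bernoulli's inequality bounds [k (s / t - 1)] by [(s / t) ^ k]. *)
Lemma Num_lty t : 0 < t -> (t%:E < rho w)%E -> (Num t < +oo)%E.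
Proof.
move=> t0 tr; have [s ts sr] : exists2 s, t < s & (s%:E < rho w)%E.
  case: (rho w) tr => [r|_|]//=; last by exists (t + 1); rewrite ?ltry// ltrDl.
  by rewrite lte_fin => tr; exists ((t + r) / 2); rewrite ?lte_fin; lra.
have s0 := lt_trans t0 ts; have Ps := Phi_lty (ltW s0) sr.
have Ps_fin : Phi w s \is a fin_num.
  by rewrite ge0_fin_numE//; exact/nnser_ge0/(fun k => term0 k (ltW s0)).
have d0 : 0 < s / t - 1 by rewrite subr_gt0 ltr_pdivlMr// mul1r.
apply: le_lt_trans (ltry (fine (Phi w s) / (s / t - 1))).
apply: nnser_le => [k|B]; first exact: nterm0 (ltW t0).
rewrite lee_fin ler_pdivlMr// mulrC mulr_sumr -lee_fin fineK//.
apply: le_trans (nnser_ge B (fun k => term0 k (ltW s0))); rewrite lee_fin.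
apply: ler_sum => k _; have u0 : 0 <= s / t by rewrite divr_ge0// ltW.
have := expr_ge_bernoulli k u0.
have -> : s ^+ k = t ^+ k * (s / t) ^+ k by rewrite -exprMn mulrC divfK// gt_eqF.
move=> /(ler_wpM2l (term0 k (ltW t0))); have := term0 k (ltW t0).
rewrite -[k%:R * w k * _]mulrA [w k * (_ * _)]mulrA.
by move: (w k * t ^+ k) ((s / t) ^+ k) (s / t) => y z x; lra.
Qed.

Let phi t := fine (Phi w t).
Let num t := fine (Num t).

Let phiE t : 0 <= t -> (t%:E < rho w)%E -> Phi w t = (phi t)%:E.
Proof.
move=> t0 tr; rewrite fineK// ge0_fin_numE ?Phi_lty//.
by apply: nnser_ge0 => k; exact: term0.
Qed.

Let numE t : 0 < t -> (t%:E < rho w)%E -> Num t = (num t)%:E.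
Proof.
move=> t0 tr; rewrite fineK// ge0_fin_numE ?Num_lty//.
by apply: nnser_ge0 => k; exact: nterm0 (ltW t0).
Qed.

Let phi_gt0 t : 0 <= t -> (t%:E < rho w)%E -> 0 < phi t.
Proof.
move=> t0 tr; apply: lt_le_trans w0_gt0 _.
by rewrite -lee_fin -phiE//; exact: Phi_gew0.
Qed.

Let num_ge0 t : 0 < t -> (t%:E < rho w)%E -> 0 <= num t.
Proof.
by move=> t0 tr; rewrite -lee_fin -numE// nnser_ge0// => k; exact: nterm0 (ltW t0).
Qed.

Lemma PsiE t : 0 < t -> (t%:E < rho w)%E -> Psi w t = (num t / phi t)%:E.
Proof.
move=> t0 tr; rewrite /Psi -/(Num t) numE// phiE ?ltW// inver.
by rewrite gt_eqF ?phi_gt0 ?ltW.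
Qed.

(** Symmetrizing the double sum, each pair of indices contributes
    [(i - j) (t^i s^j - s^i t^j)], up to a nonnegative factor. *)
Lemma cross_sum_le s t B : 0 < s <= t ->
  (\sum_(k < B) k%:R * w k * s ^+ k) * (\sum_(k < B) w k * t ^+ k) <=
  (\sum_(k < B) k%:R * w k * t ^+ k) * (\sum_(k < B) w k * s ^+ k).
Proof.
move=> /andP[s0 st]; have t0 := lt_le_trans s0 st.
rewrite -subr_ge0 !mulr_suml.
pose g (i j : 'I_B) := i%:R * (w i * w j * (t ^+ i * s ^+ j - s ^+ i * t ^+ j)).
have -> : \sum_(i < B) i%:R * w i * t ^+ i * (\sum_(k < B) w k * s ^+ k) -
    \sum_(i < B) i%:R * w i * s ^+ i * (\sum_(k < B) w k * t ^+ k) =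
    \sum_i \sum_j g i j.
  rewrite -sumrB; apply: eq_bigr => i _; rewrite !mulr_sumr -sumrB.
  by apply: eq_bigr => j _; rewrite /g; ring.
rewrite -(@pmulr_rge0 _ 2)// mulr_natl mulr2n.
rewrite {2}exchange_big -big_split sumr_ge0// => i _.
rewrite -big_split sumr_ge0//= => j _.
have -> : g i j + g j i =
    w i * w j * ((i%:R - j%:R) * (t ^+ i * s ^+ j - s ^+ i * t ^+ j)).
  by rewrite /g; ring.
apply: mulr_ge0; first by rewrite mulr_ge0.
have pw (k l : nat) : (k <= l)%N -> s ^+ l * t ^+ k <= t ^+ l * s ^+ k.
  move=> kl; rewrite -(subnK kl) !exprD -!mulrA [t ^+ k * _]mulrC ler_wpM2r//.
    by rewrite mulr_ge0 ?exprn_ge0// ltW.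
  by apply: lerXn2r; rewrite ?nnegrE ?(ltW s0) ?(ltW t0).
have [ij|/ltnW ji] := leqP i j.
  apply: mulr_le0; rewrite subr_le0 ?ler_nat//.
  by rewrite mulrC [leRHS]mulrC pw.
by apply: mulr_ge0; rewrite subr_ge0 ?ler_nat// pw.
Qed.

Lemma Psi_mono s t : 0 < s <= t -> (t%:E < rho w)%E -> (Psi w s <= Psi w t)%E.
Proof.
move=> /[dup] st' /andP[s0 st] tr; have t0 := lt_le_trans s0 st.
have sr : (s%:E < rho w)%E by apply: le_lt_trans tr; rewrite lee_fin.
have ps : 0 < phi s by apply: phi_gt0 => //; exact: ltW.
have pt : 0 < phi t by apply: phi_gt0 => //; exact: ltW.
rewrite !PsiE// lee_fin ler_pdivrMr// [leRHS]mulrAC ler_pdivlMr//.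
apply: (@nnser_prod_le _ (fun k => k%:R * w k * s ^+ k) (fun k => w k * t ^+ k)).
- by move=> k; rewrite nterm0// ltW.
- by move=> k; rewrite term0// ltW.
- by rewrite -numE.
- by rewrite -phiE// ltW.
move=> B B'; pose D := maxn B B'.
apply: (@le_trans _ _ ((\sum_(k < D) k%:R * w k * s ^+ k) *
    (\sum_(k < D) w k * t ^+ k))).
  apply: ler_pM.
  - by apply: sumr_ge0 => k _; rewrite nterm0// ltW.
  - by apply: sumr_ge0 => k _; rewrite term0// ltW.
  - rewrite -!(big_mkord xpredT (fun k => k%:R * w k * s ^+ k)).
    rewrite (@big_cat_nat _ _ _ B 0 D)//= ?leq_maxl// lerDl sumr_ge0// => k _.
    by rewrite nterm0// ltW.
  - rewrite -!(big_mkord xpredT (fun k => w k * t ^+ k)).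
    rewrite (@big_cat_nat _ _ _ B' 0 D)//= ?leq_maxr// lerDl sumr_ge0// => k _.
    by rewrite term0// ltW.
apply: le_trans (cross_sum_le D st') _; apply: ler_pM.
- by apply: sumr_ge0 => k _; rewrite nterm0// ltW.
- by apply: sumr_ge0 => k _; rewrite term0// ltW.
- have := nnser_ge D (fun k => nterm0 k (ltW t0)).
  by rewrite -/(Num t) numE.
- have := nnser_ge D (fun k => term0 k (ltW s0)).
  by rewrite -/(Phi w s) (phiE (ltW s0) sr).
Qed.

(** As [Psi] is monotone, a limit at most 1 bounds it by 1 throughout. *)
Lemma num_le_phi : (0 < rho w)%E ->
  (lim (Psi w t @[t --> from_below (rho w)]) <= 1)%E ->
  forall t, 0 < t -> (t%:E < rho w)%E -> num t <= phi t.
Proof.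
move=> r0 L1 t t0 tr.
have : (Psi w t <= lim (Psi w t @[t --> from_below (rho w)]))%E.
  apply: (@le_lim_from_below _ (rho w) (Psi w) 0) => //.
  - move=> s s0 sr; rewrite PsiE// lee_fin divr_ge0 ?num_ge0// ltW// phi_gt0//.
    exact: ltW.
  - exact: Psi_mono.
move=> /le_trans/(_ L1); rewrite PsiE// lee_fin ler_pdivrMr ?mul1r//.
by apply: phi_gt0 => //; exact: ltW.
Qed.

(** While the mean stays below 1, the generating function grows at most
    linearly. *)
Lemma phi_le_linear s t : 0 < s <= t -> (t%:E < rho w)%E -> num t <= phi t ->
  phi t * s <= phi s * t.
Proof.
move=> /[dup] st' /andP[s0 st] tr nphi; have t0 := lt_le_trans s0 st.
have sr : (s%:E < rho w)%E by apply: le_lt_trans tr; rewrite lee_fin.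
have u1 : 0 <= 1 - s / t by rewrite subr_ge0 ler_pdivrMr// mul1r.
have : phi t <= phi s + (1 - s / t) * phi t.
  rewrite -lee_fin -(phiE (ltW t0) tr); apply: nnser_le => [k|B].
    by rewrite term0// ltW.
  rewrite lee_fin; apply: le_trans (sum_pow_le B w_ge0 st' (lexx t)) _.
  apply: lerD.
    have := nnser_ge B (fun k => term0 k (ltW s0)).
    by rewrite -/(Phi w s) (phiE (ltW s0) sr).
  apply: ler_wpM2l => //; apply: le_trans nphi.
  have := nnser_ge B (fun k => nterm0 k (ltW t0)).
  by rewrite -/(Num t) numE.
rewrite -(ler_pM2r t0) mulrDl mulrAC mulrBl divfK ?gt_eqF// mul1r.
by lra.
Qed.

(** At an infinite radius, or if the generating function blows up at the radius,
    its growth would be superlinear. *)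
Lemma Psi_lim_le1 : (0 < rho w)%E ->
  (lim (Psi w t @[t --> from_below (rho w)]) <= 1)%E ->
  exists r, [/\ 0 < r, rho w = r%:E & (Phi w r < +oo)%E].
Proof.
move=> r0 L1; have nphi := num_le_phi r0 L1.
have partial B t : 0 < t -> (t%:E < rho w)%E -> \sum_(k < B) w k * t ^+ k <= phi t.
  move=> t0 tr; have := nnser_ge B (fun k => term0 k (ltW t0)).
  by rewrite -/(Phi w t) (phiE (ltW t0) tr).
have linear s t : 0 < s <= t -> (t%:E < rho w)%E -> phi t * s <= phi s * t.
  move=> /[dup] st' /andP[s0 st] tr; apply: phi_le_linear => //.
  by apply: nphi => //; exact: lt_le_trans st.
case: (rho w) r0 nphi partial linear => [r||]//= r0 nphi partial linear; last first.
  have [k [k2 wk]] := w_gt0.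
  pose t := 1 + phi 1 / w k.
  have t1 : 1 <= t.
    rewrite lerDl divr_ge0 ?(ltW wk)//; apply: le_trans (partial 0 1 _ _) => //.
      by rewrite big_ord0.
    by rewrite ltry.
  have t0 : 0 < t by lra.
  have := linear 1 t; rewrite ltr01 t1 mulr1 ltry => /(_ isT isT) lin.
  have := partial k.+1 t t0 (ltry t); rewrite big_ord_recr/= => part.
  have s0 : 0 <= \sum_(i < k) w i * t ^+ i.
    by apply: sumr_ge0 => i _; rewrite term0// ltW.
  have t2 : t ^+ 2 <= t ^+ k by rewrite ler_weXn2l.
  have h1 : w k * t ^+ 2 <= phi 1 * t.
    apply: le_trans lin; apply: le_trans part.
    by apply: le_trans (ler_wpM2l (ltW wk) t2) _; rewrite lerDr.
  have : w k * t = w k + phi 1 by rewrite /t mulrDr mulr1 mulrC divfK ?gt_eqF.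
  by move: h1; rewrite expr2 mulrA ler_pM2r//; lra.
rewrite lte_fin in r0; exists r; split => //.
have half : ((r / 2)%:E < r%:E)%E by rewrite lte_fin; lra.
apply: le_lt_trans (ltry (2 * phi (r / 2))).
apply: nnser_le => [k|B]; first by rewrite term0// ltW.
rewrite lee_fin.
have gfE x : (gf B w).[x] = \sum_(k < B) w k * x ^+ k by rewrite horner_poly.
have cv : (gf B w).[t] @[t --> r^'-] --> (gf B w).[r].
  by apply: cvg_at_left_filter; exact: continuous_horner.
rewrite -gfE; apply: (cvgr_to_le cv); near=> t; rewrite gfE.
have rt : r / 2 < t by near: t; apply: nbhs_left_gt; lra.
have tr : t < r by near: t; exact: nbhs_left_lt.
have t0 : 0 < t by lra.
apply: le_trans (partial B t t0 _) _; first by rewrite lte_fin.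
have h0 : 0 < r / 2 by lra.
have := linear (r / 2) t; rewrite h0 (ltW rt) lte_fin tr => /(_ isT isT) lin.
have ph : 0 <= phi (r / 2).
  by have := partial 0%N _ h0 half; rewrite big_ord0.
rewrite -(ler_pM2r h0); apply: le_trans lin _.
have := ler_wpM2l ph (ltW tr); lra.
Unshelve. all: by end_near. Qed.

(** Unless [rho] is 0, a value [nu <= 1] comes from a finite sum at the radius. *)
Lemma nu_le1 : (nu w <= 1)%E -> rho w = 0%E \/
  exists r, [/\ 0 < r, rho w = r%:E, (Phi w r < +oo)%E & nu w = Psi w r].
Proof.
move=> nu1; have := rho_ge0; rewrite le_eqVlt => /predU1P[<-|r0]; [by left|right].
have [L1|L1] := leP (lim (Psi w t @[t --> from_below (rho w)])) 1%E.
  have [r [r_gt0 rE Pr]] := Psi_lim_le1 r0 L1.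
  by exists r; split => //; rewrite /nu rE Pr.
move: nu1; rewrite /nu; case rE : (rho w) r0 => [r||]//= r0.
  case: ifP => [Pr _|_]; first by rewrite lte_fin in r0; exists r.
  by move: L1; rewrite rE /= => L1 /(lt_le_trans L1); rewrite ltxx.
by move: L1; rewrite rE /= => L1 /(lt_le_trans L1); rewrite ltxx.
Qed.

Section AtRadius.
Variable r : R.
Hypothesis r_gt0 : 0 < r.
Hypothesis rhoE : rho w = r%:E.
Hypothesis Phi_r : (Phi w r < +oo)%E.

Let Phi_rE : Phi w r = (phi r)%:E.
Proof.
by rewrite fineK// ge0_fin_numE//; apply: nnser_ge0 => k; rewrite term0// ltW.
Qed.

Let phi_r_gt0 : 0 < phi r.
Proof.
apply: lt_le_trans w0_gt0 _.
by rewrite -lee_fin -Phi_rE; apply: Phi_gew0; exact: ltW.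
Qed.

Lemma at_radius_rho : at_radius w r (phi r).
Proof.
have t0' k := term0 k (ltW r_gt0).
split=> //.
- by move=> B; have := nnser_ge B t0'; rewrite -/(Phi w r) Phi_rE.
- move=> e e0; have : ((phi r - e)%:E < Phi w r)%E by rewrite Phi_rE lte_fin gtrBl.
  by move=> /(nnser_gt t0')[B /ltW]; rewrite lee_fin => ?; exists B.
- move=> t rt A; have t0 : 0 <= t by rewrite ltW// (lt_trans r_gt0).
  have : (A%:E < Phi w t)%E by rewrite Phi_ey// ?ltry// rhoE lte_fin.
  by move=> /(nnser_gt (fun k => term0 k t0))[B /ltW]; rewrite lee_fin => ?; exists B.
Qed.

Lemma Num_at_radius : (Psi w r <= 1)%E -> Psi w r = (num r / phi r)%:E /\
  forall B, \sum_(k < B) k%:R * w k * r ^+ k <= num r.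
Proof.
have nt0 k := nterm0 k (ltW r_gt0).
have : (0 <= Num r)%E by exact: nnser_ge0.
have iE : ((phi r)%:E^-1 = (phi r)^-1%:E)%E by rewrite inver gt_eqF.
rewrite /Psi -/(Num r) Phi_rE iE => /gee0P[->|[N N0 NE]].
  by rewrite gt0_mulye ?lte_fin ?invr_gt0// leye_eq.
rewrite /num NE => _; split => // B.
by have := nnser_ge B nt0; rewrite -/(Num r) NE.
Qed.

(** If the second moment at the radius were finite, [Psi] would be Lipschitz
    below it, and the limit of its derivative finite. *)
Lemma sigma2_infinite : (Psi w r <= 1)%E -> sigma2 w = +oo%E ->
  forall A, exists B, A <= \sum_(k < B) (k%:R - 1) ^+ 2 * (w k * r ^+ k).
Proof.
move=> Psi1 sig A; apply: contrapT => /forallNP nB.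
have small B : \sum_(k < B) (k%:R - 1) ^+ 2 * (w k * r ^+ k) <= A.
  by rewrite leNgt; apply/negP => /ltW; exact: nB.
have [rg0 F0 Fle _ _] := at_radius_rho.
pose Q := 4 * A + phi r.
have Qle B : \sum_(k < B) k%:R * (k%:R * w k) * r ^+ k <= Q.
  apply: (@le_trans _ _ (4 * \sum_(k < B) (k%:R - 1) ^+ 2 * (w k * r ^+ k) +
      \sum_(k < B) w k * r ^+ k)); last by rewrite lerD// ler_wpM2l.
  rewrite mulr_sumr -big_split; apply: ler_sum => k _ /=.
  have y0 := term0 k (ltW r_gt0).
  rewrite -!mulrA; move: (w k * r ^+ k) y0 => y y0.
  rewrite !mulrA -[X in _ <= _ + X]mul1r -mulrDl ler_wpM2r//.
  case: {k}(k : nat) => [|[|k]].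
  - by lra.
  - by lra.
  have : 2 <= k.+2%:R :> R by rewrite ler_nat.
  by move: (k.+2%:R : R) => x; nra.
have Q0 : 0 <= Q by apply: le_trans (Qle 0%N); rewrite big_ord0.
pose C := 2 * Q / (r * w 0%N).
have C0 : 0 <= C by rewrite divr_ge0 ?mulr_ge0// ltW.
have lip x y : r / 2 < x <= y -> y < r ->
    fine (Psi w y) - fine (Psi w x) <= C * (y - x).
  move=> /andP[rx xy] yr.
  have x0 : 0 < x by apply: lt_trans rx; rewrite divr_gt0.
  have y0 : 0 < y by exact: lt_le_trans xy.
  have xr : x < r by exact: le_lt_trans yr.
  have xrho : (x%:E < rho w)%E by rewrite rhoE lte_fin.
  have yrho : (y%:E < rho w)%E by rewrite rhoE lte_fin.
  rewrite !PsiE//= -/(num y) -/(num x) -/(phi y) -/(phi x).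
  have px : w 0%N <= phi x.
    by rewrite -lee_fin -(phiE (ltW x0) xrho); apply: Phi_gew0; exact: ltW.
  have pxy : phi x <= phi y.
    rewrite -lee_fin -(phiE (ltW x0) xrho) -(phiE (ltW y0) yrho).
    by apply: Phi_mono; rewrite (ltW x0).
  have px0 : 0 < phi x by exact: lt_le_trans px.
  have py0 : 0 < phi y by exact: lt_le_trans pxy.
  have ny : num y <= num x + (1 - x / y) * Q.
    rewrite -lee_fin -numE//; apply: nnser_le => [k|B].
      by rewrite nterm0// ltW.
    have xy' : 0 < x <= y by rewrite x0.
    have v0 k : 0 <= k%:R * w k by rewrite mulr_ge0.
    rewrite lee_fin; apply: le_trans (sum_pow_le B v0 xy' (ltW yr)) _.
    apply: lerD.
      have := nnser_ge B (fun k => nterm0 k (ltW x0)).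
      by rewrite -/(Num x) numE.
    by rewrite ler_wpM2l// subr_ge0 ler_pdivrMr// mul1r.
  have xyr : 1 - x / y <= 2 / r * (y - x).
    rewrite (_ : 1 - x / y = (y - x) / y); last by field; rewrite gt_eqF.
    rewrite mulrC ler_wpM2r ?subr_ge0// -[leRHS]invrK lef_pV2 ?posrE ?invf_div//.
      by lra.
    by rewrite divr_gt0.
  have nx0 : 0 <= num x by exact: num_ge0.
  have ny0 : 0 <= num y by exact: num_ge0.
  apply: (@le_trans _ _ ((num y - num x) / phi x)).
    by rewrite mulrBl lerB// ler_wpM2l// lef_pV2.
  rewrite ler_pdivrMr//.
  apply: (@le_trans _ _ (2 / r * (y - x) * Q)).
    have := ler_wpM2r Q0 xyr; lra.
  have -> : 2 / r * (y - x) * Q = C * (y - x) * w 0%N.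
    by rewrite /C; field; rewrite !gt_eqF.
  by rewrite ler_wpM2l// mulr_ge0// subr_ge0.
have PG : ProperFilter (r^'-) by exact: at_left_proper_filter.
have dle t : r / 2 < t < r -> derive1 (fun t => fine (Psi w t)) t <= C.
  by move=> tr; apply: (derive1_le tr C0).
have lim_le : (lim ((derive1 (fun t => fine (Psi w t)) t)%:E @[t --> r^'-]) <= C%:E)%E.
  (* Without a limit, [lim] takes the default value 0. *)
  have [cv|ncv] := pselect (cvg ((derive1 (fun t => fine (Psi w t)) t)%:E @[t --> r^'-])).
    apply: lime_le => //; near=> t; rewrite lee_fin; apply: dle.
    apply/andP; split; near: t; last exact: nbhs_left_lt.
    by apply: nbhs_left_gt; rewrite ltr_pdivrMr// ltr_pMr// ltr1n.
  by rewrite (dvgP ncv) lee_fin.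
move: sig; rewrite /sigma2 rhoE /= => sig.
have : (r%:E * lim ((derive1 (fun t => fine (Psi w t)) t)%:E @[t --> r^'-]) <=
  r%:E * C%:E)%E by apply: lee_wpmul2l => //; rewrite lee_fin ltW.
by rewrite sig leye_eq.
Unshelve. all: by end_near. Qed.

End AtRadius.

Lemma flat_rare_of_criteria K :
  (nu w < 1)%E \/ (nu w = 1%E /\ sigma2 w = +oo%E) -> flat_rare w K.
Proof.
move=> h; have nu1 : (nu w <= 1)%E by case: h => [/ltW //|[-> _]].
have [r0|[r [r_gt0 rE Pr nuE]]] := nu_le1 nu1.
  apply: flat_rare_zero_radius => // t t0 A.
  have : (A%:E < Phi w t)%E by rewrite Phi_ey ?ltry ?r0 ?lte_fin// ltW.
  by move=> /(nnser_gt (fun k => term0 k (ltW t0)))[B /ltW]; rewrite lee_fin; exists B.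
have rad := at_radius_rho r_gt0 rE Pr; have [_ F0 _ _ _] := rad.
have Psi1 : (Psi w r <= 1)%E by rewrite -nuE.
have [PsiNE mean] := Num_at_radius r_gt0 Pr Psi1.
have mean' B : \sum_(k < B) k%:R * (w k * r ^+ k) <= num r.
  by apply: le_trans (mean B); apply: ler_sum => k _; rewrite mulrA.
move: h; rewrite nuE => -[|[P1 sig]].
  rewrite PsiNE lte_fin => nu_lt1.
  apply: (@flat_rare_subcritical _ w r (phi r) (num r / phi r)) => // B.
  by rewrite divfK ?gt_eqF.
have NF : num r <= phi r.
  by move: Psi1; rewrite PsiNE lee_fin ler_pdivrMr// mul1r.
apply: (@flat_rare_infinite_variance _ w r (phi r)) => //.
  by move=> B; exact: le_trans (mean' B) NF.
exact: sigma2_infinite r_gt0 rE Pr Psi1 sig.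
Qed.

End Criteria.

(** * Deep nodes of simply generated trees are rare *)

Section DeepNodes.
Context {R : realType}.
Variable w : nat -> R.
Hypothesis w_ge0 : forall k, 0 <= w k.
Implicit Types (n h : nat) (K th b D r : R).

Lemma partition_function_powcoef n : (0 < n)%N ->
  n%:R * partition_function w n = powcoef w n n.-1.
Proof.
move=> n0; rewrite partition_functionE.
by have := cycle_lemma w 1 n.-1; rewrite add1n prednK// mul1r.
Qed.

Lemma prod_tilt_le1 n (c : 'I_n -> nat) th : (0 < n)%N ->
  (\sum_i c i = n.-1)%N -> 0 <= th <= 1 ->
  0 <= \prod_i (1 + th * ((c i)%:R - 1)) <= 1.
Proof.
move=> n0 sumc /andP[th0 th1].
have term0 i : 0 <= 1 + th * ((c i)%:R - 1).
  by have : 0 <= (c i)%:R :> R by []; nra.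
rewrite prodr_ge0//=; apply: (@le_trans _ _ (\prod_i expR (th * ((c i)%:R - 1)))).
  by apply: ler_prod => i _; rewrite term0 expR_ge1Dx.
rewrite -expR_sum -[leRHS]expR0 ler_expR -mulr_sumr mulr_ge0_le0//.
rewrite sumrB -natr_sum sumc sumr_const card_ord subr_le0 ler_nat.
exact: leq_pred.
Qed.

(** The product of the tilts is small at sequences with a large second moment, and
    at most 1 at the others. *)
Lemma powcoef_tilted_le n th K b : (0 < n)%N -> 0 <= th <= 1 -> 1 <= b ->
  b ^+ 2 <= th ^+ 2 * (K * n%:R) ->
  powcoef (fun k => w k * (1 + th * (k%:R - 1))) n n.-1 <=
  expR (- b / 16) * powcoef w n n.-1 + flat_weight w K n.
Proof.
move=> n0 th01 b1 bY; rewrite !(@powcoef_sum _ n) ?prednK//.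
rewrite /flat_weight big_mkcondr mulr_sumr -big_split; apply: ler_sum => c /eqP sumc /=.
have p0 : 0 <= \prod_i w (c i) by apply: prodr_ge0.
have /andP[t0 t1] := prod_tilt_le1 n0 sumc th01.
rewrite big_split/= mulrC; case: ifPn => [X|].
  rewrite -[X in _ + X]mul1r -mulrDl ler_wpM2r// (le_trans t1)// lerDr.
  exact: expR_ge0.
rewrite -leNgt addr0 => X; apply: ler_wpM2r => //.
have b2 : Num.sqrt (b ^+ 2) = b by rewrite sqrtr_sqr ger0_norm//; lra.
rewrite -[in leRHS]b2; apply: prod_tilt_le => //.
  by nra.
by apply: le_trans bY _; rewrite ler_wpM2l ?sqr_ge0.
Qed.

Lemma deep_weight_small K D r n h b : (0 < h <= n)%N ->
  flat_weight w K n <= D * r ^+ n * powcoef w n n.-1 -> 1 <= b ->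
  4 * n%:R * b ^+ 2 <= h%:R ^+ 2 * K ->
  deep_weight w h n 0 <=
  2 * (expR (- b / 16) + D * r ^+ n) * (n%:R * partition_function w n).
Proof.
move=> /[dup] hn /andP[h0 h_le] flat b1 bK.
have n0 : (0 < n)%N := leq_trans h0 h_le.
have nR : 0 < n%:R :> R by rewrite ltr0n.
rewrite partition_function_powcoef//.
apply: le_trans (deep_weight_le_tilted w_ge0 hn) _; rewrite -mulrA ler_pM2l//.
set th := h%:R / _.
have th01 : 0 <= th <= 1.
  have : h%:R <= n%:R :> R by rewrite ler_nat.
  rewrite divr_ge0 ?mulr_ge0//= ler_pdivrMr ?mulr_gt0//; lra.
have bY : b ^+ 2 <= th ^+ 2 * (K * n%:R).
  have -> : th ^+ 2 * (K * n%:R) = h%:R ^+ 2 * K / (4 * n%:R).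
    by rewrite /th; field; rewrite gt_eqF.
  by rewrite ler_pdivlMr ?mulr_gt0// mulrC.
rewrite mulrDl; apply: le_trans (powcoef_tilted_le n0 th01 b1 bY) _.
by rewrite lerD2l.
Qed.

End DeepNodes.

(** * From weights to probabilities *)

Section Probability.
Context {R : realType}.
Variables (w : nat -> R) (n : nat).
Hypothesis w_ge0 : forall k, 0 <= w k.
Hypothesis Z_gt0 : 0 < partition_function w n.
Context {d : measure_display} {Omega : measurableType d}.
Variables (P : probability Omega R) (T : {RV P >-> plane_tree}).
Hypothesis T_sg : is_simply_generated w n T.

Let mT (A : set plane_tree) : measurable (T @^-1` A).
Proof. exact: measurable_funPTI. Qed.

Let prob_seq (s : seq plane_tree) : uniq s -> {in s, forall t, tree_size t = n} ->
  P (T @^-1` [set` s]) =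
  (\sum_(t <- s) tree_weight w t / partition_function w n)%:E.
Proof.
elim: s => [_ _|t s IH /= /andP[ts us] sn].
  by rewrite big_nil set_nil preimage_set0 measure0.
have -> : [set` t :: s] = [set t] `|` [set` s].
  by apply/seteqP; split => x /=; rewrite inE => /predU1P.
rewrite preimage_setU measureU//; last first.
  by apply/seteqP; split => x //= [-> /=]; rewrite (negbTE ts).
rewrite big_cons EFinD; congr (_ + _)%E.
  by apply: T_sg; apply: sn; rewrite mem_head.
by apply: IH => // x xs; apply: sn; rewrite inE xs orbT.
Qed.

(** Markov's inequality for a function of the tree that is at least 1 on the
    event; almost surely the tree has size [n]. *)
Lemma simply_generated_le (A : set plane_tree) (g : plane_tree -> R) :
  (forall t, 0 <= g t) -> (forall t, tree_size t = n -> A t -> 1 <= g t) ->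
  (P (T @^-1` A) <= ((\sum_(f <- forests n 1) forest_weight w f * g (head leaf f)) /
    partition_function w n)%:E)%E.
Proof.
move=> g0 g1; pose ts := trees n.
have size_ts : {in ts, forall t, tree_size t = n} by move=> t; rewrite mem_trees => /eqP.
have full : P (T @^-1` [set` ts]) = 1%E.
  rewrite prob_seq ?uniq_trees// -mulr_suml -partition_function_trees divff//.
  by rewrite gt_eqF.
pose s := [seq t <- ts | `[< A t >]].
have sub : T @^-1` A `<=` T @^-1` [set` s] `|` T @^-1` (~` [set` ts]).
  move=> x /= Ax; have [xt|xt] := boolP (T x \in ts); [left|right].
    by rewrite mem_filter xt andbT; apply/asboolP.
  exact/negP.
apply: (@le_trans _ _ (P (T @^-1` [set` s] `|` T @^-1` (~` [set` ts])))).
  apply: le_measure sub; rewrite inE; first exact: mT.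
  by apply: measurableU; exact: mT.
apply: le_trans (measureU2 _ _ _) _; [exact: mT|exact: mT|].
have null : P (T @^-1` (~` [set` ts])) = 0%E.
  rewrite preimage_setC; apply: etrans (probability_setC P (mT [set` ts])) _.
  by transitivity (1 - 1 : \bar R)%E; [congr (1 - _)%E; exact: full|exact: subee].
have us : uniq s by rewrite filter_uniq// uniq_trees.
have ss : {in s, forall t, tree_size t = n}.
  by move=> t; rewrite mem_filter => /andP[_]; exact: size_ts.
have prob_s := prob_seq us ss.
apply: (@le_trans _ _
    ((\sum_(t <- s) tree_weight w t / partition_function w n)%:E + 0)%E).
  by apply: leeD; [rewrite -prob_s|rewrite -null].
rewrite adde0.
rewrite lee_fin -mulr_suml -big_trees ler_pM2r ?invr_gt0// big_filter big_mkcond.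
rewrite big_seq [leRHS]big_seq; apply: ler_sum => t tts.
have tw0 : 0 <= tree_weight w t by exact: prodr_ge0.
case: asboolP => At; last by rewrite mulr_ge0.
by rewrite ler_peMr// g1// size_ts.
Qed.

Lemma deep_prob_le (A : set plane_tree) h (a : R) : 0 <= a ->
  (forall t, tree_size t = n -> A t -> 1 <= a * (deep_nodes h t)%:R) ->
  (P (T @^-1` A) <= (a * deep_weight w h n 0 / partition_function w n)%:E)%E.
Proof.
move=> a0 Aa; apply: le_trans (simply_generated_le (fun t => mulr_ge0 a0 (ler0n _ _)) Aa) _.
rewrite lee_fin ler_pM2r ?invr_gt0// mulr_sumr ler_sum// => f _.
by rewrite mulrCA.
Qed.

End Probability.

(** * Elementary asymptotics *)

Section Asymptotics.
Context {R : realType}.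
Implicit Types (c e : R) (n N : nat).

Lemma nat_above_near (x : R) : exists N, forall n, (N <= n)%N -> x <= n%:R.
Proof.
have [N _ xN] := nat_above x; exists N => n Nn.
by apply: le_trans xN _; rewrite ler_nat.
Qed.

Lemma geometric_small (r : R) e : 0 <= r < 1 -> 0 < e ->
  exists N, forall n, (N <= n)%N -> n%:R * r ^+ n <= e.
Proof.
move=> /andP[r0 r1] e0; pose c := 1 - r; have c0 : 0 < c by rewrite subr_gt0.
have [N hN] := nat_above_near (1 + 2 / (c ^+ 2 * e)); exists N => n /hN nN.
have ce : 0 < c ^+ 2 * e by rewrite mulr_gt0// exprn_gt0.
have n1 : 0 < n%:R :> R.
  by apply: lt_le_trans nN; rewrite ltr_pwDl// divr_ge0// ltW.
have rn : r ^+ n <= expR (- (c * n%:R)).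
  rewrite -mulNr expRM_natr; apply: lerXn2r; rewrite ?nnegrE ?expR_ge0//.
  by apply: le_trans (expR_ge1Dx _); rewrite /c; lra.
apply: (@le_trans _ _ (n%:R * expR (- (c * n%:R)))); first by rewrite ler_wpM2l.
rewrite expRN ler_pdivrMr ?expR_gt0//.
have := expR_ge1Dxn 1 (mulr_ge0 (ltW c0) (ltW n1)).
have -> : 2`!%:R = 2 :> R by [].
move=> H; apply: (@le_trans _ _ (e * ((c * n%:R) ^+ 2 / 2))); last first.
  by rewrite ler_wpM2l ?(ltW e0)//; apply: le_trans H; rewrite lerDr.
have : 2 / (c ^+ 2 * e) <= n%:R by lra.
rewrite ler_pdivrMr// => h.
have -> : e * ((c * n%:R) ^+ 2 / 2) = n%:R * (n%:R * (c ^+ 2 * e) / 2) by field.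
by rewrite ler_peMr ?(ltW n1)//; lra.
Qed.

Lemma expR_sqrt_small c e : 0 < c -> 0 < e ->
  exists N, forall n, (N <= n)%N -> n%:R * expR (- (c * Num.sqrt n%:R)) <= e.
Proof.
move=> c0 e0; have ce : 0 < c ^+ 4 * e by rewrite mulr_gt0// exprn_gt0.
have [N hN] := nat_above_near (24 / (c ^+ 4 * e)); exists N => n /hN nN.
have n0 : 0 <= n%:R :> R by [].
rewrite expRN ler_pdivrMr ?expR_gt0//.
have y0 : 0 <= c * Num.sqrt n%:R by rewrite mulr_ge0 ?sqrtr_ge0// ltW.
have := expR_ge1Dxn 3 y0; rewrite exprMn.
have -> : Num.sqrt n%:R ^+ 4 = n%:R ^+ 2 :> R.
  by rewrite (exprM _ 2 2) sqr_sqrtr.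
have -> : 4`!%:R = 24 :> R by [].
move=> H; apply: (@le_trans _ _ (e * (c ^+ 4 * n%:R ^+ 2 / 24))); last first.
  by rewrite ler_wpM2l ?(ltW e0)//; apply: le_trans H; rewrite lerDr.
move: nN; rewrite ler_pdivrMr// => h.
have -> : e * (c ^+ 4 * n%:R ^+ 2 / 24) = n%:R * (n%:R * (c ^+ 4 * e) / 24) by field.
by rewrite ler_peMr//; lra.
Qed.

Lemma ln_above_near (x : R) : exists N, forall n, (N <= n)%N -> x <= ln n%:R.
Proof.
have [N hN] := nat_above_near (expR x); exists N => n /hN xn.
have n0 : 0 < n%:R :> R by apply: lt_le_trans xn; exact: expR_gt0.
by rewrite -(expRK x) ler_ln ?posrE ?expR_gt0.
Qed.

Lemma expR_ln3_small c e : 0 < c -> 0 < e ->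
  exists N, forall n, (N <= n)%N -> n%:R * expR (- (c * ln n%:R ^+ 3)) <= e.
Proof.
move=> c0 e0; have [N1 h1] := nat_above_near (1 + e^-1).
have [N2 h2] := ln_above_near (1 + 2 / c).
exists (maxn N1 N2) => n; rewrite geq_max => /andP[/h1 n1 /h2 n2].
have ei : 0 < e^-1 by rewrite invr_gt0.
have n0 : 0 < n%:R :> R by lra.
have cc : 0 < 2 / c by rewrite divr_gt0.
have key : 2 * ln n%:R <= c * ln n%:R ^+ 3.
  have : 2 <= c * ln n%:R by rewrite mulrC -ler_pdivrMr//; lra.
  move: n2; set l := ln _ => n2 h.
  have l1 : 1 <= l by lra.
  have : 2 <= c * l * l by nra.
  by rewrite !exprS expr0 mulr1 !mulrA => ?; rewrite ler_wpM2r//; lra.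
apply: (@le_trans _ _ (n%:R * expR (- (2 * ln n%:R)))).
  by rewrite ler_wpM2l// ler_expR lerN2.
rewrite expRN expRM_natl lnK ?posrE// expr2 invfM mulrA divff ?gt_eqF// mul1r.
by rewrite -[leRHS]invrK lef_pV2 ?posrE//; lra.
Qed.

Lemma expR_small e : 0 < e -> exists2 x, 1 <= x & expR (- x) <= e.
Proof.
move=> e0; exists (1 + e^-1); first by rewrite lerDl invr_ge0 ltW.
rewrite expRN -[leRHS]invrK lef_pV2 ?posrE ?expR_gt0 ?invr_gt0//.
by apply: le_trans (expR_ge1Dx _); lra.
Qed.

Lemma within_near (D Q : set nat) : (exists N, forall n, (N <= n)%N -> D n -> Q n) ->
  \forall n \near within D \oo, Q n.
Proof. by move=> [N NQ]; exists N. Qed.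

Lemma cvge_within (D : set nat) (f : nat -> \bar R) (l : R) :
  (forall e : R, 0 < e -> exists N, forall n, (N <= n)%N -> D n ->
    ((l - e)%:E <= f n <= (l + e)%:E)%E) ->
  f n @[n --> within D \oo] --> l%:E.
Proof.
move=> H; apply: cvg_EFin.
  apply: within_near; have [N hN] := H 1 ltr01; exists N => n Nn Dn.
  by have := hN n Nn Dn; case: (f n) => [x| |]//=; rewrite ?leeNy_eq ?leye_eq ?andbF.
apply/cvgrPdist_le => e e0; apply: within_near.
have [N hN] := H e e0; exists N => n Nn Dn; have := hN n Nn Dn.
rewrite /=; case: (f n) => [x| |]//=; rewrite ?leeNy_eq ?leye_eq ?andbF//.
by rewrite !lee_fin ler_norml => /andP[? ?]; apply/andP; split; lra.
Qed.

End Asymptotics.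

(** * Height and width *)

Section HeightWidth.
Context {R : realType}.
Variable w : nat -> R.
Hypothesis w_ge0 : forall k, 0 <= w k.
Hypothesis rare : forall K : R, flat_rare w K.

Lemma truncn_ge_half (x : R) : 2 <= x -> x / 2 <= (Num.truncn x)%:R.
Proof.
move=> x2; have x0 : 0 <= x by lra.
by have /andP[_] := truncn_itv x0; rewrite -natr1; lra.
Qed.

(** A tree of height at least [h] has a node at distance at least [h], and the
    expected number of such nodes is at most [n] times an expression that decays
    faster than any power of [n]. *)
Lemma height_tail (e del : R) : 0 < e -> 0 < del -> exists N, forall n,
  (N <= n)%N -> 0 < partition_function w n ->
  forall (d : measure_display) (Omega : measurableType d) (P : probability Omega R)
    (T : {RV P >-> plane_tree}), is_simply_generated w n T ->
  (P [set x | (e < `|(height (T x))%:R / (Num.sqrt n%:R * ln n%:R ^+ 3)|)%R] <=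
    del%:E)%E.
Proof.
move=> e0 del0; have [D [r [D0 r01 flat]]] := rare 1.
have del6 : 0 < del / 6 by rewrite divr_gt0.
have [N1 h1] := nat_above_near (4 : R).
have [N2 h2] := ln_above_near (1 + 4 / e).
have [N3 h3] := expR_ln3_small (divr_gt0 e0 (ltr0n R 64)) del6.
have [N4 h4] := expR_sqrt_small (divr_gt0 ltr01 (ltr0n R 32)) del6.
have D1 : 0 < D + 1 by lra.
have [N5 h5] := geometric_small r01 (divr_gt0 del6 D1).
exists (maxn N1 (maxn N2 (maxn N3 (maxn N4 N5)))) => n.
rewrite !geq_max => /andP[/h1 n4] /andP[/h2 nln] /andP[/h3 b3] /andP[/h4 b4 /h5 b5].
move=> Z0 d Omega P T T_sg.
have n0 : (0 < n)%N by rewrite -(ltr0n R); lra.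
have e4 : 0 < 4 / e by rewrite divr_gt0.
set q := Num.sqrt n%:R; set l := ln n%:R ^+ 3.
have q2 : q ^+ 2 = n%:R by rewrite sqr_sqrtr.
have q_ge2 : 2 <= q.
  rewrite -(@ler_pXn2r _ 2) ?nnegrE ?sqrtr_ge0//; rewrite q2; lra.
have l_ge : 4 <= e * l.
  have l1 : 4 <= e * ln n%:R by rewrite mulrC -ler_pdivrMr//; lra.
  apply: le_trans l1 _; rewrite ler_wpM2l ?(ltW e0)// /l.
  by rewrite exprS ler_peMr ?exprn_ege1//; lra.
have l0 : 0 < l by rewrite -(pmulr_rgt0 _ e0); lra.
have ql0 : 0 < q * l by rewrite mulr_gt0//; lra.
have x_ge : 2 <= e * (q * l) by rewrite mulrCA; nra.
(* The level is capped at [n], as the bound on deep nodes needs [h <= n]; a tree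
   of height at least [h] has a node at distance [h] in any case. *)
pose h := minn (Num.truncn (e * (q * l))) n.
pose b := Num.min (e / 4 * l) (q / 2).
have half := truncn_ge_half x_ge.
have h0 : (0 < h)%N.
  rewrite leq_min n0 andbT -(ltr0n R); apply: lt_le_trans half; lra.
have hn : (0 < h <= n)%N by rewrite h0 geq_minr.
have b1 : 1 <= b by rewrite le_min; apply/andP; split; lra.
have qb : 2 * q * b <= h%:R.
  have b_le1 : b <= e / 4 * l by rewrite ge_min lexx.
  have b_le2 : b <= q / 2 by rewrite ge_min lexx orbT.
  have q0 : 0 <= 2 * q by lra.
  rewrite /h; case: (leqP (Num.truncn (e * (q * l))) n) => _.
    have := ler_wpM2l q0 b_le1; move: half; lra.
  have := ler_wpM2l q0 b_le2; rewrite -q2; lra.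
have bK : 4 * n%:R * b ^+ 2 <= h%:R ^+ 2 * 1.
  rewrite mulr1 -q2 (_ : 4 * q ^+ 2 * b ^+ 2 = (2 * q * b) ^+ 2); last by ring.
  by apply: lerXn2r; rewrite ?nnegrE// !mulr_ge0//; lra.
have nZ : 0 < powcoef w n n.-1.
  by rewrite -partition_function_powcoef// mulr_gt0// ltr0n.
have deep := deep_weight_small w_ge0 hn (flat n n0 nZ) b1 bK.
pose A := [set t | (e < `|(height t)%:R / (q * l)|)%R].
have A_deep t : tree_size t = n -> A t -> 1 <= 1 * (deep_nodes h t)%:R :> R.
  move=> _; rewrite /A /= ger0_norm ?divr_ge0 ?(ltW ql0)// ltr_pdivlMr// => ht.
  rewrite mul1r ler1n; apply: deep_nodes_gt0; rewrite h0 -(ler_nat R).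
  apply: le_trans (ltW ht); apply: (@le_trans _ _ (Num.truncn (e * (q * l)))%:R).
    by rewrite ler_nat geq_minl.
  by rewrite truncn_le; lra.
have PA := deep_prob_le w_ge0 Z0 T_sg ler01 A_deep.
apply: le_trans PA _.
rewrite lee_fin mul1r ler_pdivrMr//; apply: le_trans deep _.
rewrite mulrA ler_pM2r//.
have exp_b : expR (- b / 16) <= expR (- (e / 64 * l)) + expR (- (1 / 32 * q)).
  rewrite /b; case: (leP (e / 4 * l) (q / 2)) => _.
    rewrite (_ : - (e / 4 * l) / 16 = - (e / 64 * l)); last by field.
    by rewrite lerDl expR_ge0.
  rewrite (_ : - (q / 2) / 16 = - (1 / 32 * q)); last by field.
  by rewrite lerDr expR_ge0.
have b5' : D * (n%:R * r ^+ n) <= del / 6.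
  have := ler_wpM2l D0 b5; have : D * (del / 6 / (D + 1)) <= del / 6.
    by rewrite mulrA ler_pdivrMr// mulrC ler_wpM2l ?(ltW del6)//; lra.
  by lra.
have := ler_wpM2l (ler0n R n) exp_b; move: b3 b4 b5'; rewrite -/l -/q.
by move: (n%:R : R) (r ^+ n) (expR _) (expR _) (expR _) => *; lra.
Qed.

(** If the width is below [C sqrt(n)], the lowest [sqrt(n) / 2C] levels hold at
    most half of the nodes, so at least half of the nodes are deep: by Markov's
    inequality this has small probability. *)
Lemma width_tail (K del : R) : 0 < del -> exists N, forall n,
  (N <= n)%N -> 0 < partition_function w n ->
  forall (d : measure_display) (Omega : measurableType d) (P : probability Omega R)
    (T : {RV P >-> plane_tree}), is_simply_generated w n T ->
  (P [set x | ((width (T x))%:R / Num.sqrt n%:R < K)%R] <= del%:E)%E.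
Proof.
move=> del0; have del8 : 0 < del / 8 by rewrite divr_gt0.
have [x x1 hx] := expR_small del8.
pose C := Num.max K 1; have C1 : 1 <= C by rewrite le_max lexx orbT.
have KC : K <= C by rewrite le_max lexx.
pose b := 16 * x; have b1 : 1 <= b by rewrite /b; lra.
(* With [h >= sqrt(n) / 4C], this second moment makes the exponent at least
   [b / 16 = x]. *)
have [D [r [D0 r01 flat]]] := rare (64 * C ^+ 2 * b ^+ 2).
have D1 : 0 < D + 1 by lra.
have [N1 h1] := nat_above_near ((4 * C) ^+ 2).
have [N2 h2] := geometric_small r01 (divr_gt0 del8 D1).
exists (maxn N1 N2) => n; rewrite geq_max => /andP[/h1 nC /h2 nr].
move=> Z0 d Omega P T T_sg.
have nR1 : 1 <= n%:R :> R by apply: le_trans nC; rewrite exprn_ege1//; lra.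
have n0 : (0 < n)%N by rewrite -(ltr0n R); lra.
set q := Num.sqrt n%:R.
have q2 : q ^+ 2 = n%:R by rewrite sqr_sqrtr.
have qC : 4 * C <= q.
  rewrite -(@ler_pXn2r _ 2) ?nnegrE ?sqrtr_ge0//; first by rewrite q2.
  by lra.
have C20 : 0 < 2 * C by lra.
have y2 : 2 <= q / (2 * C) by rewrite ler_pdivlMr//; lra.
pose h := Num.truncn (q / (2 * C)).
have half := truncn_ge_half y2; rewrite -/h in half.
have h_le : h%:R <= q / (2 * C) by rewrite truncn_le; lra.
have hC : h%:R * (2 * C) <= q by rewrite -ler_pdivlMr.
have hn : (0 < h <= n)%N.
  apply/andP; split; first by rewrite -(ltr0n R); lra.
  rewrite -(ler_nat R) -q2; have : 0 <= h%:R :> R by [].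
  by move: (h%:R : R) hC => y hC y0; nra.
have bK : 4 * n%:R * b ^+ 2 <= h%:R ^+ 2 * (64 * C ^+ 2 * b ^+ 2).
  have qh : q <= 4 * C * h%:R.
    move: half; rewrite -[q / (2 * C) / 2]mulrA -invfM ler_pdivrMr; lra.
  have : q ^+ 2 <= (4 * C * h%:R) ^+ 2.
    by apply: lerXn2r; rewrite ?nnegrE ?sqrtr_ge0// mulr_ge0//; lra.
  have b20 : 0 <= 4 * b ^+ 2 by rewrite mulr_ge0 ?sqr_ge0.
  by move=> /(ler_wpM2l b20); rewrite q2; lra.
have nZ : 0 < powcoef w n n.-1.
  by rewrite -partition_function_powcoef// mulr_gt0// ltr0n.
have deep := deep_weight_small w_ge0 hn (flat n n0 nZ) b1 bK.
pose A := [set t | ((width t)%:R / q < K)%R].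
have q0 : 0 < q by lra.
have nR0 : 0 < n%:R :> R by lra.
have a0 : 0 <= 2 / n%:R :> R by rewrite divr_ge0.
have A_deep t : tree_size t = n -> A t -> 1 <= 2 / n%:R * (deep_nodes h t)%:R :> R.
  move=> tn; rewrite /A /= ltr_pdivrMr// => wt.
  rewrite mulrAC ler_pdivlMr// mul1r.
  have := tree_size_le_width h t; rewrite tn -(ler_nat R) natrD natrM => nle.
  have wt' : (width t)%:R <= C * q :> R.
    by apply: le_trans (ltW wt) _; rewrite ler_wpM2r// ltW.
  have : h%:R * (width t)%:R * 2 <= n%:R :> R.
    apply: (@le_trans _ _ (h%:R * (C * q) * 2)).
      by rewrite ler_wpM2r// ler_wpM2l.
    rewrite -q2 (_ : h%:R * (C * q) * 2 = h%:R * (2 * C) * q); last by ring.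
    by rewrite expr2 ler_wpM2r// ltW.
  by move: nle; lra.
have PA := deep_prob_le w_ge0 Z0 T_sg a0 A_deep.
apply: le_trans PA _.
rewrite lee_fin ler_pdivrMr//.
apply: le_trans (ler_wpM2l a0 deep) _.
have -> : 2 / n%:R * (2 * (expR (- b / 16) + D * r ^+ n) *
    (n%:R * partition_function w n)) =
    4 * (expR (- b / 16) + D * r ^+ n) * partition_function w n.
  by field; rewrite gt_eqF.
rewrite ler_pM2r//.
have -> : - b / 16 = - x by rewrite /b; field.
have r0 : 0 <= r ^+ n by rewrite exprn_ge0//; case/andP: r01.
have : D * r ^+ n <= del / 8.
  have h3 : r ^+ n <= del / 8 / (D + 1).
    by apply: le_trans nr; rewrite ler_peMl.
  have := ler_wpM2l D0 h3; have : D * (del / 8 / (D + 1)) <= del / 8.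
    by rewrite mulrA ler_pdivrMr// mulrC ler_wpM2l ?(ltW del8)//; lra.
  by lra.
by lra.
Qed.

End HeightWidth.

Unset Implicit Arguments.
Set Strict Implicit.

Theorem mainTheorem5 (R : realType) (w : nat -> R)
  (w_ge0 : forall k, 0 <= w k) (w0_gt0 : 0 < w 0%N)
  (w_gt0 : exists k, (2 <= k)%N /\ 0 < w k)
  (d : nat -> measure_display) (Omega : forall n, measurableType (d n))
  (P : forall n, probability (Omega n) R)
  (T : forall n, {RV (P n) >-> plane_tree})
  (T_sg : forall n, 0 < partition_function w n -> is_simply_generated w n (T n))
  (h : (nu w < 1)%E \/ (nu w = 1%E /\ sigma2 w = +oo%E)) :
  let F := within [set n | 0 < partition_function w n] \oo in
  cvg0_in_probability P F
    (fun n x => (height (T n x))%:R / (Num.sqrt n%:R * ln n%:R ^+ 3)) /\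
  cvgy_in_probability P F
    (fun n x => (width (T n x))%:R / Num.sqrt n%:R).
Proof.
have rare K : flat_rare w K by exact: flat_rare_of_criteria.
split=> [e e0|K]; apply: cvge_within => del del0.
  have [N hN] := height_tail w_ge0 rare e0 del0; exists N => n Nn Zn.
  rewrite sub0r add0r; apply/andP; split.
    by apply: le_trans (measure_ge0 _ _); rewrite lee_fin oppr_le0 ltW.
  exact: hN (T_sg n Zn).
have [N hN] := width_tail w_ge0 rare K del0; exists N => n Nn Zn.
pose A := [set t | ((width t)%:R / Num.sqrt n%:R < K)%R].
have mA : measurable (T n @^-1` A) by exact: measurable_funPTI.
have -> : [set x | K <= (width (T n x))%:R / Num.sqrt n%:R] = ~` (T n @^-1` A).
  by apply/seteqP; split => x /=; rewrite /A /= leNgt => /negP.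
have PA := hN n Nn Zn _ _ _ _ (T_sg n Zn).
apply/andP; split; last first.
  apply: le_trans (probability_le1 _ (measurableC mA)) _.
  by rewrite lee_fin lerDl ltW.
rewrite probability_setC// EFinB leeB//.
Qed.
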